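(* Let $E/\mathbb{F}_3$ be the elliptic curve $y^2=x^3-x$. Then $j(E)=0$, and $E$ has precisely twelve automorphisms (over $\overline{\mathbb{F}_3}$). These are given by $$\Phi_{u,r}\colon E\longrightarrow E,\qquad (x,y)\longmapsto (u^2x+r,\,u^3y),$$ where $u^4=1$ and $r\in\mathbb{F}_3$. Let $n\ge 1$ and $q=3^n$. For $u\in\mathbb{F}_9$ with $u^4=1$ and $r\in\mathbb{F}_3$ put $$C_{u,r}=\{\Phi_{u',r'}^{-1}\circ\Phi_{u,r}\circ\Phi_{u'^q,r'^q}\mid (u')^4=1,\ r'\in\mathbb{F}_3\}$$ (this is the Frobenius conjugacy class of $\Phi_{u,r}$ over $\mathbb{F}_q$). Let $i\in\mathbb{F}_9$ with $i^2=-1$. (a) If $n$ is odd, then the Frobenius conjugacy classes of $E/\mathbb{F}_q$ are $$C_{1,0}=\{\Phi_{1,0},\Phi_{-1,0}\},\quad C_{1,1}=\{\Phi_{1,1},\Phi_{-1,-1}\},\quad C_{1,-1}=\{\Phi_{1,-1},\Phi_{-1,1}\},\quad C_{i,0}=\{\Phi_{u,r}\mid u^2=-1,\ r\in\mathbb{F}_3\}.$$ In particular there are precisely three non-trivial twists of $E$ over $\mathbb{F}_q$ in case $n$ is odd, which are given as follows. The cocycle defined by $\mathrm{Fr}\mapsto\Phi_{u,0}$, with $u^2=-1$, corresponds to the twist $E^{\mathrm{tw}}\colon y^2=x^3+x$, and the corresponding isomorphism is defined over a quadratic extension. The cocycle $\mathrm{Fr}\mapsto\Phi_{1,1}$ corresponds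 to the twist $E^{\mathrm{tw}}\colon y^2=x^3-x-1$, and the cocycle $\mathrm{Fr}\mapsto\Phi_{1,-1}$ corresponds to the twist $E^{\mathrm{tw}}\colon y^2=x^3-x+1$, where both isomorphisms are defined over a cubic extension. (b) If $n$ is even (so $i\in\mathbb{F}_q$), the Frobenius conjugacy classes of $E/\mathbb{F}_q$ are $$C_{1,0}=\{\Phi_{1,0}\},\quad C_{-1,0}=\{\Phi_{-1,0}\},\quad C_{1,1}=\{\Phi_{1,1},\Phi_{1,-1}\},\quad C_{-1,1}=\{\Phi_{-1,1},\Phi_{-1,-1}\},$$ $$C_{i,0}=\{\Phi_{i,r}\mid r\in\mathbb{F}_3\},\quad C_{-i,0}=\{\Phi_{-i,r}\mid r\in\mathbb{F}_3\}.$$ The isomorphisms between $E$ and the twists corresponding to these classes are defined over a field extension of $\mathbb{F}_q$ of degree $1,2,3,6,4,4$, respectively. Equivalently, the number of $\mathbb{F}_{3^n}$-isomorphism classes of elliptic curves over $\mathbb{F}_{3^n}$ with $j$-invariant $0$ (i.e., of supersingular elliptic curves over $\mathbb{F}_{3^n}$) is $4$ when $n$ is odd and $6$ when $n$ is even.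
   Context: A twist of an elliptic curve $E/K$ is an elliptic curve $E^{\mathrm{tw}}/K$ that is isomorphic to $E$ over $\overline{K}$; two twists are considered equal if they are isomorphic over $K$, and a twist is trivial if it is isomorphic to $E$ over $K$. The twists of $E/K$ are in bijection with $H^1(\mathrm{G}_{\overline{K}/K},\mathrm{Aut}_{\overline{K}}(E))$, where $\mathrm{G}_{\overline{K}/K}$ is the absolute Galois group. For $K=\mathbb{F}_q$, $\mathrm{Fr}$ denotes the automorphism of $\overline{\mathbb{F}_q}$ raising every element to its $q$-th power; it acts on morphisms by acting on the coefficients of the defining rational functions. For $\tau\in\mathrm{Aut}_{\overline{\mathbb{F}_q}}(E)$, the Frobenius conjugacy class of $\tau$ is $\{\sigma^{-1}\tau({}^{\mathrm{Fr}}\sigma)\mid\sigma\in\mathrm{Aut}_{\overline{\mathbb{F}_q}}(E)\}$. The twists of $E/\mathbb{F}_q$ are in one-to-one correspondence with the Frobenius conjugacy classes in $\mathrm{Aut}_{\overline{\mathbb{F}_q}}(E)$. A continuous cocycle is determined by its value at $\mathrm{Fr}$. A twist $E^{\mathrm{tw}}$ with isomorphism $\psi\colon E\to E^{\mathrm{tw}}$ over $\overline{\mathbb{F}_q}$ corresponds to the Frobenius conjugacy class containing $({}^{\mathrm{Fr}}\psi)^{-1}\circ\psi$.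
   Formalization: In (a), the twists y²=x³−x∓1 match Φ_{1,±1} as printed only for n≡2 mod 3; they are interchanged for n≡1 mod 3. For 3|n both are trivial twists, so for all odd n the curves y²=x³−x∓d with d in F_q of trace −1 over F_3 are given instead. *)

(* Defs.v *)
From HB Require Import structures.
From mathcomp Require Import all_boot all_order all_algebra all_field.
From mathcomp Require Import boolp classical_sets functions cardinality.
From mathcomp Require Import mpoly ring.

Set Implicit Arguments.
Unset Strict Implicit.
Unset Printing Implicit Defensive.

Import GRing.Theory.
Local Open Scope classical_set_scope.
Local Open Scope ring_scope.

(* Throughout, K plays the role of the algebraic closure of F_3 and fields of
   definition are subsets L of K; L = predT means "over the closure".
   For q = 3 ^ m with m > 0, [Fq q] is the subfield of K with q elements. *)
Definition Fq (K : nzRingType) (q : nat) : {pred K} := [pred x | x ^+ q == x].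
Arguments Fq K q : clear implicits.

Record weierstrass (K : Type) :=
  Weierstrass { a1 : K; a2 : K; a3 : K; a4 : K; a6 : K }.

Section Invariants.
Variables (K : fieldType) (E : weierstrass K).

Definition b2 := a1 E ^+ 2 + 4%:R * a2 E.
Definition b4 := 2%:R * a4 E + a1 E * a3 E.
Definition b6 := a3 E ^+ 2 + 4%:R * a6 E.
Definition b8 := a1 E ^+ 2 * a6 E + 4%:R * a2 E * a6 E - a1 E * a3 E * a4 E
                 + a2 E * a3 E ^+ 2 - a4 E ^+ 2.
Definition c4 := b2 ^+ 2 - 24%:R * b4.
Definition disc := - b2 ^+ 2 * b8 - 8%:R * b4 ^+ 3 - 27%:R * b6 ^+ 2
                   + 9%:R * b2 * b4 * b6.
Definition jinv := c4 ^+ 3 / disc.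

Definition elliptic_over (L : {pred K}) : Prop :=
  [/\ a1 E \in L, a2 E \in L, a3 E \in L, a4 E \in L & a6 E \in L] /\
  disc != 0.

End Invariants.

(* A point of P^2 on a Weierstrass cubic is either [0 : 1 : 0] or of the form
   [x : y : 1]. *)
Variant ppoint (K : Type) := Infty | Affine of K & K.
Arguments Infty {K}.

Section Points.
Variable K : fieldType.
Implicit Type E : weierstrass K.

Definition on_curve E : pred (ppoint K) := fun P =>
  if P is Affine x y then
    y ^+ 2 + a1 E * x * y + a3 E * y
      == x ^+ 3 + a2 E * x ^+ 2 + a4 E * x + a6 E
  else true.

Record point E := Point { pt :> ppoint K; _ : on_curve E pt }.
HB.instance Definition _ E := [isSub for @pt E].

Definition Opt E : point E := @Point E Infty isT.

Definition hcoord (P : ppoint K) : 'I_3 -> K := fun i =>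
  nth 0 (if P is Affine x y then [:: x; y; 1] else [:: 0; 1; 0]) i.

Definition form_triple (d : nat) (L : {pred K}) (F : 'I_3 -> {mpoly K[3]}) :=
  forall i, F i \is d.-homog /\ F i \is a mpolyOver 3 L.

Definition defined_at (F : 'I_3 -> {mpoly K[3]}) (P : ppoint K) : Prop :=
  exists i, (F i).@[hcoord P] != 0.

(* phi is [F_0 : F_1 : F_2] wherever the F_i do not all vanish. *)
Definition represents E E' (F : 'I_3 -> {mpoly K[3]})
    (phi : point E -> point E') : Prop :=
  forall Q : point E, defined_at F Q ->
    exists2 c : K, c != 0 & forall i, hcoord (phi Q) i = c * (F i).@[hcoord Q].

(* Morphisms of projective curves, identified with their action on the
   K-points (K algebraically closed): near every point they are given by
   forms of equal degree, with coefficients in L. *)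
Definition is_morphism (L : {pred K}) E E' (phi : point E -> point E') : Prop :=
  forall P : point E, exists d F,
    [/\ form_triple d L F, defined_at F P & represents F phi].

Definition is_iso (L : {pred K}) E E' (phi : point E -> point E') : Prop :=
  [/\ is_morphism L phi, phi (Opt E) = Opt E' &
      exists psi : point E' -> point E,
        [/\ is_morphism L psi, cancel phi psi & cancel psi phi]].

Definition iso_over (L : {pred K}) E E' : Prop :=
  exists phi : point E -> point E', is_iso L phi.

Definition iso_class (L : {pred K}) E : set (weierstrass K) :=
  [set E' | elliptic_over E' L /\ iso_over L E E'].

Definition ECAut E : set (point E -> point E) := [set phi | is_iso predT phi].

(* The group law (chord and tangent formulas), needed for supersingularity. *)
Definition padd E (P Q : ppoint K) : ppoint K :=
  match P, Q with
  | Infty, _ => Q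
  | _, Infty => P
  | Affine x1 y1, Affine x2 y2 =>
      let third l :=
        let x3 := l ^+ 2 + a1 E * l - a2 E - x1 - x2 in
        Affine x3 (- (l * (x3 - x1) + y1) - a1 E * x3 - a3 E) in
      if x1 == x2 then
        if y1 + y2 + a1 E * x2 + a3 E == 0 then Infty
        else third ((3%:R * x1 ^+ 2 + 2%:R * a2 E * x1 + a4 E - a1 E * y1)
                    / (2%:R * y1 + a1 E * x1 + a3 E))
      else third ((y2 - y1) / (x2 - x1))
  end.

(* E[p] = 0, for K algebraically closed of characteristic p. *)
Definition supersingular (p : nat) E : Prop :=
  forall P : point E, iter p (padd E P) Infty = Infty -> P = Opt E.

End Points.
Arguments ECAut {K} E _.

Section Frobenius.
Variables (K : fieldType) (q : nat).
Implicit Types E : weierstrass K.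

(* phi' is ^Fr phi: the coefficients of all forms defining phi are raised to
   the q-th power.  Used for E, E' over F_q, and phi a morphism. *)
Definition is_Fr E E' (phi phi' : point E -> point E') : Prop :=
  forall d F, form_triple d predT F -> represents F phi ->
    represents (fun i => map_mpoly (fun x : K => x ^+ q) (F i)) phi'.

Definition is_inverse E E' (f : point E -> point E') (g : point E' -> point E) :=
  cancel f g /\ cancel g f.

(* { sigma^-1 tau (^Fr sigma) | sigma in Aut(E) } *)
Definition Frob_class E (tau : point E -> point E) : set (point E -> point E) :=
  [set rho | exists s s' t, [/\ ECAut E s, is_Fr s s', is_inverse s t &
                                rho = t \o tau \o s']].

Definition Frob_classes E : set (set (point E -> point E)) :=
  [set Frob_class tau | tau in ECAut E].

(* tau = (^Fr psi)^-1 \o psi *)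
Definition cocycle_value E E' (psi : point E -> point E')
    (tau : point E -> point E) : Prop :=
  exists psi' t, [/\ is_Fr psi psi', is_inverse psi' t & tau = t \o psi].

(* The least extension of F_q over which psi is defined has degree d. *)
Definition defined_in_degree (d : nat) E E' (psi : point E -> point E') :=
  is_iso (Fq K (q ^ d)) psi /\
  forall m, (0 < m)%N -> is_iso (Fq K (q ^ m)) psi -> (d <= m)%N.

(* The cocycle Fr |-> tau corresponds to the twist E' of E over F_q, and the
   isomorphisms inducing it are defined exactly in degree d. *)
Definition cocycle_twist E (tau : point E -> point E) E' (d : nat) : Prop :=
  [/\ elliptic_over E' (Fq K q),
      exists psi : point E -> point E', is_iso predT psi /\ cocycle_value psi tau &
      forall psi : point E -> point E', is_iso predT psi ->
        cocycle_value psi tau -> defined_in_degree d psi].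

(* The Frobenius class C comes from a twist of E over F_q, and all
   isomorphisms from E to such a twist are defined exactly in degree d. *)
Definition class_degree E (C : set (point E -> point E)) (d : nat) : Prop :=
  (exists E' (psi : point E -> point E') tau,
     [/\ elliptic_over E' (Fq K q), is_iso predT psi,
         cocycle_value psi tau & C tau]) /\
  (forall E' (psi phi : point E -> point E') tau,
     elliptic_over E' (Fq K q) -> is_iso predT psi ->
     cocycle_value psi tau -> C tau ->
     is_iso predT phi -> defined_in_degree d phi).

Definition nontrivial_twist_classes E : set (set (weierstrass K)) :=
  [set iso_class (Fq K q) E' | E' in
     [set E' | [/\ elliptic_over E' (Fq K q), iso_over predT E E' &
                   ~ iso_over (Fq K q) E E']]].

End Frobenius.
Arguments Frob_classes {K} q E _.

(* y^2 = x^3 + a x + b *)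
Definition short (K : nzRingType) (a b : K) : weierstrass K :=
  Weierstrass 0 0 0 a b.

(* y^2 = x^3 - x *)
Definition E0 (K : nzRingType) : weierstrass K := short (-1) 0.
Arguments E0 K : clear implicits.

Section Phi.
Variable K : fieldType.

Definition Phi_fun (u r : K) (P : ppoint K) : ppoint K :=
  if P is Affine x y then Affine (u ^+ 2 * x + r) (u ^+ 3 * y) else Infty.

(* [insubd] only supplies a default value: for u ^+ 4 = 1 and r in F_3 the
   point [Phi_fun u r P] lies on the curve, see [PhiE]. *)
Definition Phi (u r : K) (P : point (E0 K)) : point (E0 K) :=
  insubd (Opt (E0 K)) (Phi_fun u r P).

Lemma PhiE (u r : K) (P : point (E0 K)) : 3%N \in [pchar K] ->
  u ^+ 4 = 1 -> r \in Fq K 3 -> Phi u r P = Phi_fun u r P :> ppoint K.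
Proof.
move=> /pcharf0 char3 u4 /eqP r3; rewrite /Phi; apply: insubdK.
case: P => [[|x y]] //=; rewrite !(mul0r, addr0) => /eqP Exy.
rewrite unfold_in /= !(mul0r, addr0); apply/eqP.
have u6 : u ^+ 6 = u ^+ 2 by rewrite -[6%N]/(4 + 2)%N exprD u4 mul1r.
have -> : (u ^+ 3 * y) ^+ 2 = u ^+ 6 * y ^+ 2 by ring.
have -> : (u ^+ 2 * x + r) ^+ 3 = u ^+ 6 * x ^+ 3 + r ^+ 3
    + 3%:R * (u ^+ 4 * x ^+ 2 * r + u ^+ 2 * x * r ^+ 2) by ring.
by rewrite char3 r3 u6 Exy; ring.
Qed.

(* C_{u,r}, for F_q *)
Definition Cset (q : nat) (u r : K) : set (point (E0 K) -> point (E0 K)) :=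
  [set rho | exists u' r' t,
     [/\ u' ^+ 4 = 1, r' \in Fq K 3, is_inverse (Phi u' r') t &
         rho = t \o Phi u r \o Phi (u' ^+ q) (r' ^+ q)]].

(* The trace of F_(3^n) over F_3; y^2 = x^3 - x - d is a trivial twist of
   y^2 = x^3 - x over F_(3^n) if and only if d has trace 0. *)
Definition trace3 (n : nat) (d : K) : K := \sum_(k < n) d ^+ (3 ^ k).

End Phi.

(* Main.v *)
Require Import Defs.
From HB Require Import structures.
From mathcomp Require Import all_boot all_order all_algebra all_field.
From mathcomp Require Import boolp classical_sets functions cardinality.
From mathcomp Require Import mpoly ring zify.

(** In characteristic 3 every isomorphism of Weierstrass curves is an affine
    substitution described by a pair (u, r), and the theorem becomes a
    computation with such pairs.

    Put z = a1 x + a3 - y, which is 2 y + a1 x + a3 in characteristic 3.  The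
    affine part of a curve becomes z^2 = f(x), where
    f = x^3 + b2 x^2 - b4 x + b6.  An isomorphism that fixes the origin
    restricts to the affine parts, where its coordinates are locally quotients
    of forms; as the curve is affine they are polynomials a(x) + b(x) z
    ([regular_local]).  The pole order of a(x) + b(x) z at infinity is the
    degree of its norm a^2 - f b^2, hence multiplicative.  Pulling back along
    the isomorphism multiplies all pole orders by one constant k, and since x
    and z are themselves pullbacks, k divides their pole orders 2 and 3; so
    k = 1 and the isomorphism is (x, z) |-> (u^2 x + r, u^3 z)
    ([affine_iso], [is_iso_scalept]).  Frobenius raises u and r to the q-th
    power ([is_Fr_scalept]), and the isomorphism is defined over F_q exactly
    when u and r are in F_q ([is_iso_Fq]).

    For the source y^2 = x^3 - x, the pair (u, r) leads to E' if and only if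
    u != 0, b2 = 0, b4 = u^4 and b6 = u^4 r - r^3 ([curve_isoP]).  With E' = E
    this gives the automorphisms; since b2 = 0 means j = 0, it also shows that
    the curves with j = 0 are the twists of E.  The cocycle of (u, r) is
    Phi_{v,s} with v = u / u^q and s = (r - r^q) / u^(2q) ([cocycle_valueP]).
    The cocycles of a twist form one set C_{v,s} ([cocyclesE]), this set
    determines the twist ([cocycles_iso]), and every C_{v,s} occurs, because
    u^q = u / v and the Artin-Schreier equation r^q = r - s u^(2q) can be
    solved ([twist_exists]).  So twists are counted by counting the sets
    C_{v,s}, and degrees of definition are lengths of Frobenius orbits of
    (u, r), which v and s determine ([cocycle_frob]).

    Finally P = (x, z) is killed by 3 if and only if z != 0 and
    (b2 x + b4)^2 = b2 z^2 ([three_torsion]), and an elliptic curve has such a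
    point unless b2 = 0. *)

Set Implicit Arguments.
Unset Strict Implicit.
Unset Printing Implicit Defensive.

Import GRing.Theory.
Local Open Scope classical_set_scope.
Local Open Scope card_scope.
Local Open Scope ring_scope.

Local Notation point := Defs.point.

(** * Regular functions on an affine curve z^2 = f(x) *)

Section AffineCurve.
Variables (K : closedFieldType) (f : {poly K}).
Hypothesis size_f : size f = 4%N.
Implicit Types (h k : {poly K} * {poly K}) (g : K -> K -> K) (p : {poly K}).

Lemma sqrt_exists (a : K) : exists b, b ^+ 2 = a.
Proof.
have /closed_rootP [b] : size ('X^2 - a%:P) != 1%N by rewrite size_XnsubC.
by rewrite /root !hornerE subr_eq0 => /eqP; exists b.
Qed.

Lemma poly_eq0_horner p : (forall x, p.[x] = 0) -> p = 0.
Proof.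
move=> p0; have : ~~ (size (p + 1)%R != 1%N).
  by apply/closed_rootP => -[x]; rewrite /root !hornerE p0 add0r oner_eq0.
rewrite negbK => /size_poly1P [c c0 pE].
have pc : p = (c - 1)%:P by rewrite polyCB -pE addrK.
by have := p0 0; rewrite pc hornerC => ->.
Qed.

(** The pair (a, b) stands for the function a(x) + b(x) z. *)
Definition ev h (x z : K) : K := h.1.[x] + h.2.[x] * z.
(** The product of a(x) + b(x) z and its conjugate a(x) - b(x) z. *)
Definition norm h : {poly K} := h.1 ^+ 2 - f * h.2 ^+ 2.
Definition conjp h := (h.1, - h.2).
Definition mulp h k := (h.1 * k.1 + f * h.2 * k.2, h.1 * k.2 + h.2 * k.1).

Lemma ev_conjp h x z : ev (conjp h) x z = ev h x (- z).
Proof. by rewrite /ev /= hornerN mulNr mulrN. Qed.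

Lemma ev_mul h k x z : z ^+ 2 = f.[x] ->
  ev (mulp h k) x z = ev h x z * ev k x z.
Proof. by move=> xz; rewrite /ev /= !hornerE -xz; ring. Qed.

Lemma ev_norm h x z : z ^+ 2 = f.[x] ->
  (norm h).[x] = ev h x z * ev h x (- z).
Proof. by move=> xz; rewrite /ev /norm !(hornerE, horner_exp) /= -xz; ring. Qed.

Lemma norm_mul h k : norm (mulp h k) = norm h * norm k.
Proof. by rewrite /norm /=; ring. Qed.

Lemma size_sqr p : size (p ^+ 2) = (2 * size p).-1.
Proof.
have [->|p0] := eqVneq p 0; first by rewrite expr0n size_poly0.
by rewrite expr2 size_mul // mul2n addnn.
Qed.

(** The degree of a^2 is even and that of f b^2 is odd, so the two terms of
    the norm cannot cancel. *)
Lemma size_norm h : size (norm h) =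
  maxn (2 * size h.1).-1 (if h.2 == 0 then 0%N else (2 * size h.2).+2).
Proof.
have f0 : f != 0 by rewrite -size_poly_gt0 size_f.
rewrite /norm; case: eqP => [->|/eqP h20].
  by rewrite expr0n mulr0 subr0 size_sqr maxn0.
have h2p : (0 < size h.2)%N by rewrite size_poly_gt0.
have s2 : size (f * h.2 ^+ 2) = (2 * size h.2).+2.
  by rewrite size_mul ?expf_neq0 // size_f size_sqr; lia.
case: (ltngtP (size (h.1 ^+ 2)) (size (f * h.2 ^+ 2))) => lt12.
- rewrite addrC size_polyDl ?size_polyN // s2; move: lt12.
  by rewrite size_sqr s2; lia.
- rewrite size_polyDl ?size_polyN // size_sqr; move: lt12.
  by rewrite size_sqr s2; lia.
- by move: lt12; rewrite size_sqr s2; lia.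
Qed.

Lemma norm_eq0 h : (norm h == 0) = (h == (0, 0)).
Proof.
rewrite -size_poly_eq0 size_norm; case: h => a b /=.
rewrite xpair_eqE -(size_poly_eq0 a).
by case: (b == 0); rewrite ?maxn0 ?andbT ?andbF; case: (size a) => [|s] //; lia.
Qed.

(** Every x lies below a point of the curve, so the norm vanishes at every x. *)
Lemma ev_eq0 h : (forall x z, z ^+ 2 = f.[x] -> ev h x z = 0) -> h = (0, 0).
Proof.
move=> h0; apply/eqP; rewrite -norm_eq0; apply/eqP/poly_eq0_horner => x.
by have [z xz] := sqrt_exists f.[x]; rewrite (ev_norm _ xz) h0 // mul0r.
Qed.

Lemma ev_inj h k :
  (forall x z, z ^+ 2 = f.[x] -> ev h x z = ev k x z) -> h = k.
Proof.
move=> hk; have : (h.1 - k.1, h.2 - k.2) = (0, 0).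
  apply: ev_eq0 => x z xz; rewrite -(subrr (ev k x z)) -{1}hk // /ev /=
    !hornerE /=; ring.
case=> /eqP; rewrite subr_eq0 => /eqP h1 /eqP; rewrite subr_eq0 => /eqP h2.
by case: h k h1 h2 {hk} => ? ? [? ?] /= -> ->.
Qed.

Definition agrees g h := forall x z, z ^+ 2 = f.[x] -> g x z = ev h x z.
Definition regular g := exists h, agrees g h.

Lemma regularD g g' : regular g -> regular g' ->
  regular (fun x z => g x z + g' x z).
Proof.
move=> [h gh] [h' gh']; exists (h.1 + h'.1, h.2 + h'.2) => x z xz.
by rewrite gh // gh' // /ev /= !hornerE /=; ring.
Qed.

Lemma regularM g g' : regular g -> regular g' ->
  regular (fun x z => g x z * g' x z).
Proof.
move=> [h gh] [h' gh']; exists (mulp h h') => x z xz.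
by rewrite gh // gh' // ev_mul.
Qed.

Lemma regular_poly p : regular (fun x _ => p.[x]).
Proof. by exists (p, 0) => x z _; rewrite /ev /= !hornerE. Qed.

Lemma regular_ev h : regular (ev h).
Proof. by exists h. Qed.

Lemma regular_ext g g' : (forall x z, z ^+ 2 = f.[x] -> g x z = g' x z) ->
  regular g -> regular g'.
Proof. by move=> gg' [h gh]; exists h => x z xz; rewrite -gg' // gh. Qed.

(** The Nullstellensatz for this curve.  The polynomials p in x such that g p
    is regular form an ideal of K[x].  Near the two points above a given a
    there are denominators, a combination of which vanishes at neither point,
    and its norm is an element of the ideal that does not vanish at a.  Hence
    the ideal has no common zero and contains 1. *)
Lemma regular_local g :
  (forall x z, z ^+ 2 = f.[x] -> exists h,
     ev h x z != 0 /\ regular (fun x z => g x z * ev h x z)) ->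
  regular g.
Proof.
move=> gloc.
pose den p := regular (fun x z => g x z * p.[x]).
have denD p p' : den p -> den p' -> den (p + p').
  move=> dp dp'; apply: regular_ext (regularD dp dp') => x z _.
  by rewrite hornerD mulrDr.
have denM p p' : den p -> den (p' * p).
  move=> dp; apply: regular_ext (regularM (regular_poly p') dp) => x z _.
  by rewrite hornerM mulrCA.
have den_norm h : regular (fun x z => g x z * ev h x z) -> den (norm h).
  move=> dh; apply: regular_ext (regularM (regular_ev (conjp h)) dh) => x z xz.
  by rewrite (ev_norm _ xz) ev_conjp mulrC mulrA.
have den_at a : exists2 p, p.[a] != 0 & den p.
  have [b ab] := sqrt_exists f.[a].
  have abN : (- b) ^+ 2 = f.[a] by rewrite sqrrN.
  have [h [h0 dh]] := gloc _ _ ab; have [k [k0 dk]] := gloc _ _ abN.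
  have [hN|hN] := eqVneq (ev h a (- b)) 0; last first.
    by exists (norm h); [rewrite (ev_norm _ ab) mulf_neq0|exact: den_norm].
  have [kN|kN] := eqVneq (ev k a b) 0; last first.
    by exists (norm k); [rewrite (ev_norm _ ab) mulf_neq0|exact: den_norm].
  have evD x z : ev (h.1 + k.1, h.2 + k.2) x z = ev h x z + ev k x z.
    by rewrite /ev /= !hornerE /=; ring.
  exists (norm (h.1 + k.1, h.2 + k.2)).
    by rewrite (ev_norm _ ab) !evD hN kN addr0 add0r mulf_neq0.
  apply: den_norm; apply: regular_ext (regularD dh dk) => x z _.
  by rewrite -mulrDr -evD.
suff den1 : den 1.
  by apply: regular_ext den1 => x z _; rewrite hornerC mulr1.
(* Dividing out a root a of p: the gcd of p and an element of the ideal that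
   does not vanish at a has smaller degree. *)
have [p p0 dp] := den_at 0.
have {p0} : p != 0 by apply: contraNneq p0 => ->; rewrite horner0.
have [n] := ubnP (size p); elim: n p dp => // n IHn p dp; rewrite ltnS => sp p0.
have [/size_poly1P [c c0 pc]|/closed_rootP [a pa]] := boolP (size p == 1%N).
  suff -> : 1 = c^-1%:P * p by exact: denM.
  by rewrite pc -polyCM mulVf.
have [M Ma dM] := den_at a.
have [e eqp] := Bezoutp p M; set d := _ + _ in eqp.
have dd : den d by apply: denD; exact: denM.
have d_dvd : (d %| p) /\ (d %| M).
  by split; rewrite (eqp_dvdl _ eqp) ?dvdp_gcdl ?dvdp_gcdr.
have d0 : d != 0 by apply: contraNneq p0 => d0; move: d_dvd.1; rewrite d0 dvd0p.
apply: (IHn d) => //; apply: leq_trans sp.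
rewrite ltn_neqAle dvdp_leq ?d_dvd.1 // andbT.
apply: contra Ma => sdp.
have dp' : d %= p by rewrite -dvdp_size_eqp ?d_dvd.1.
have : p %| M by rewrite -(eqp_dvdl _ dp') d_dvd.2.
by move/dvdpP => [s ->]; rewrite hornerM (rootP pa) mulr0.
Qed.

(** ** Pole orders at infinity *)

Definition pole_order g d :=
  exists2 h, agrees g h & size (norm h) = d.+1.

Lemma pole_order_uniq g d d' : pole_order g d -> pole_order g d' -> d = d'.
Proof.
move=> [h gh hd] [k gk kd'].
have hk : h = k by apply: ev_inj => x z xz; rewrite -gh // -gk.
by move: hd kd'; rewrite hk => -> [].
Qed.

Lemma pole_order_ext g g' d :
  (forall x z, z ^+ 2 = f.[x] -> g x z = g' x z) ->
  pole_order g d -> pole_order g' d.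
Proof. by move=> gg' [h gh hd]; exists h => // x z xz; rewrite -gg' // gh. Qed.

Lemma pole_orderM g g' d d' : pole_order g d -> pole_order g' d' ->
  pole_order (fun x z => g x z * g' x z) (d + d').
Proof.
move=> [h gh hd] [k gk kd']; exists (mulp h k).
  by move=> x z xz; rewrite gh // gk // ev_mul.
rewrite norm_mul size_mul -?size_poly_gt0 ?hd ?kd' //; lia.
Qed.

Local Notation sz := (@size K).

Let sizeDl p p' : (sz p' < sz p)%N -> sz (p + p')%R = sz p.
Proof. exact: size_polyDl. Qed.

Let sizeD p p' : (sz (p + p')%R <= maxn (sz p) (sz p'))%N.
Proof. exact: size_polyD. Qed.

Lemma pole_orderD g g' d d' : pole_order g d -> pole_order g' d' ->
  (d < d')%N -> pole_order (fun x z => g x z + g' x z) d'.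
Proof.
move=> [h gh hd] [k gk kd'] dd'; exists (h.1 + k.1, h.2 + k.2).
  by move=> x z xz; rewrite gh // gk // /ev /= !hornerE /=; ring.
move: hd kd'; rewrite !size_norm /=.
have [h2|h2] := eqVneq h.2 0; have [k2|k2] := eqVneq k.2 0.
- rewrite h2 k2 addr0 eqxx => h1 k1.
  by rewrite addrC sizeDl; lia.
- rewrite h2 add0r (negPf k2) => h1 k1.
  have [lt|ge] := ltnP (sz h.1) (sz k.1).
    by rewrite addrC sizeDl; lia.
  have := sizeD h.1 k.1; lia.
- rewrite k2 addr0 (negPf h2) => h1 k1.
  rewrite (_ : sz (h.1 + k.1) = sz k.1); first lia.
  by rewrite addrC sizeDl //; lia.
- move=> h1 k1.
  have [lt|ge] := ltnP (2 * sz k.1).-1 ((2 * sz k.2).+2).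
    have ltk : (sz h.2 < sz k.2)%N by lia.
    have s2 : sz (h.2 + k.2) = sz k.2 by rewrite addrC sizeDl.
    rewrite -size_poly_eq0 s2 size_poly_eq0 (negPf k2).
    have := sizeD h.1 k.1; lia.
  have ltk : (sz h.1 < sz k.1)%N by lia.
  have -> : sz (h.1 + k.1) = sz k.1 by rewrite addrC sizeDl.
  have := sizeD h.2 k.2; case: (_ == 0); lia.
Qed.

Lemma pole_order_const c : c != 0 -> pole_order (fun _ _ => c) 0.
Proof.
move=> c0; exists (c%:P, 0); first by move=> x z _; rewrite /ev /= !hornerE.
by rewrite size_norm /= eqxx size_polyC c0.
Qed.

Lemma not_pole_order_const c d : pole_order (fun _ _ => c) d.+1 -> False.
Proof.
have [->|c0] := eqVneq c 0; last first.
  by move/pole_order_uniq/(_ (pole_order_const c0)).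
case=> h h0; rewrite (_ : h = (0, 0)); last first.
  by apply: ev_eq0 => x z /h0 <-.
by rewrite size_norm /= eqxx size_poly0.
Qed.

(** If the norm of (a, b) has degree 0 then b = 0 and a is constant, by
    [size_norm]. *)
Lemma regular_const_or_pole g : regular g ->
  (exists c, forall x z, z ^+ 2 = f.[x] -> g x z = c) \/
  exists d, pole_order g d.+1.
Proof.
move=> [h gh]; case sN: (size (norm h)) => [|[|d]]; last first.
- by right; exists d, h.
- left; move: sN; rewrite size_norm.
  have [h2|h2] := eqVneq h.2 0; last lia.
  move=> s1; have /size_poly1P [c _ hc] : size h.1 == 1%N by lia.
  by exists c => x z xz; rewrite gh // /ev h2 hc !hornerE.
- left; exists 0 => x z xz; rewrite gh //.
  move/eqP: sN; rewrite size_poly_eq0 norm_eq0 => /eqP ->.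
  by rewrite /ev /= !hornerE.
Qed.

Lemma pole_order_poly g d p : pole_order g d.+1 -> p != 0 ->
  pole_order (fun x z => p.[g x z]) ((size p).-1 * d.+1).
Proof.
move=> gd; elim/poly_ind: p => [|p c IHp] pc0; first by rewrite eqxx in pc0.
have [p0|p0] := eqVneq p 0.
  move: pc0; rewrite p0 mul0r add0r polyC_eq0 => c0.
  rewrite size_polyC c0 /=; apply: pole_order_ext (pole_order_const c0) => x z
    _.
  by rewrite hornerC.
have sp : (0 < size p)%N by rewrite size_poly_gt0.
rewrite size_MXaddC (negPf p0) /=.
have gp : pole_order (fun x z => p.[g x z] * g x z) (size p * d.+1).
  have -> : (size p * d.+1 = (size p).-1 * d.+1 + d.+1)%N by case: (size p) sp
    => //= m _; lia.
  exact: pole_orderM (IHp p0) gd.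
have [->|c0] := eqVneq c 0.
  by apply: pole_order_ext gp => x z _; rewrite !hornerE.
apply: pole_order_ext (pole_orderD (pole_order_const c0) gp _) => [x z _|].
  by rewrite !hornerE addrC.
by rewrite muln_gt0 sp.
Qed.

End AffineCurve.

(** * Isomorphisms of affine curves *)

Section AffineIso.
Variables (K : closedFieldType) (f f' : {poly K}).
Hypotheses (size_f : size f = 4%N) (size_f' : size f' = 4%N).
Implicit Types (h : {poly K} * {poly K}) (p : {poly K}).
Local Notation sz := (@size K).

(** With m = k.+1, the functions p(X) and r(X) Z have the pole orders
    2 m deg p and 2 m deg r + 3 m.  These differ by an odd multiple of m, so
    the terms of p(X) + r(X) Z do not cancel. *)
Lemma pole_order_pullback X Z k h :
  pole_order f X (2 * k.+1) -> pole_order f Z (3 * k.+1) -> h != (0, 0) ->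
  pole_order f (fun x z => ev h (X x z) (Z x z)) (k.+1 * (sz (norm f' h)).-1).
Proof.
move=> pX pZ; rewrite (size_norm size_f').
have pX' : pole_order f X (2 * k + 1).+1.
  by rewrite (_ : (_ + 1).+1 = (2 * k.+1)%N) //; lia.
have pp p := pole_order_poly size_f (p := p) pX'.
case: h => p r /=; rewrite xpair_eqE.
have [->|p0] := eqVneq p 0; have [->|r0] := eqVneq r 0 => //= _.
- rewrite size_poly0 max0n.
  have sr : (0 < sz r)%N by rewrite size_poly_gt0.
  rewrite (_ : (_ * _)%N = ((sz r).-1 * (2 * k + 1).+1 + 3 * k.+1)%N); last nia.
  apply: pole_order_ext (pole_orderM size_f (pp _ r0) pZ) => x z _.
  by rewrite /ev /= horner0 add0r.
- rewrite maxn0 (_ : (_ * _)%N = ((sz p).-1 * (2 * k + 1).+1)%N); last nia.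
  apply: pole_order_ext (pp _ p0) => x z _.
  by rewrite /ev /= horner0 mul0r addr0.
- have sr : (0 < sz r)%N by rewrite size_poly_gt0.
  have sp : (0 < sz p)%N by rewrite size_poly_gt0.
  have := pole_orderM size_f (pp _ r0) pZ; have := pp _ p0.
  case: (sz r) sr => // r' _; case: (sz p) sp => // p' _ /= ppX prZ.
  have [lt|ge] := leqP (2 * p'.+1).-1 (2 * r'.+1).+2.
    rewrite (_ : (k.+1 * _)%N = (r' * (2 * k + 1).+1 + 3 * k.+1)%N); last first.
      by rewrite /=; lia.
    by apply: (pole_orderD size_f ppX prZ); nia.
  rewrite (_ : (k.+1 * _)%N = (p' * (2 * k + 1).+1)%N); last first.
    by lia.
  apply: pole_order_ext (pole_orderD size_f prZ ppX _) => [x z _|].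
    by rewrite /ev addrC.
  nia.
Qed.

Variables X Z X' Z' : K -> K -> K.
Hypotheses (regX : regular f X) (regZ : regular f Z).
Hypotheses (regX' : regular f' X') (regZ' : regular f' Z').
Hypothesis onXZ : forall x z, z ^+ 2 = f.[x] -> Z x z ^+ 2 = f'.[X x z].
Hypothesis X'K : forall x z, z ^+ 2 = f.[x] -> X' (X x z) (Z x z) = x.
Hypothesis Z'K : forall x z, z ^+ 2 = f.[x] -> Z' (X x z) (Z x z) = z.

Let pole_x : pole_order f (fun x _ => x) 2.
Proof.
exists ('X, 0); first by move=> x z _; rewrite /ev /= !hornerE.
by rewrite (size_norm size_f) /= eqxx maxn0 size_polyX.
Qed.

Let pole_z : pole_order f (fun _ z => z) 3.
Proof.
exists (0, 1); first by move=> x z _; rewrite /ev /= !hornerE.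
by rewrite (size_norm size_f) /= oner_eq0 size_poly1 size_poly0.
Qed.

(** Comparing poles in Z^2 = f'(X) gives 2 ord Z = 3 ord X.  Neither X nor Z
    is constant, since x is a function of X and Z. *)
Lemma pole_orders_affine_iso : exists k,
  pole_order f X (2 * k.+1) /\ pole_order f Z (3 * k.+1).
Proof.
have constP c d : ~ pole_order f (fun _ _ => c) d.+1.
  exact: not_pole_order_const.
case: (regular_const_or_pole size_f regX) => [[c Xc]|[d pX]].
  case: (regular_const_or_pole size_f regZ) => [[c' Zc]|[d pZ]].
    case: (constP (X' c c') 1%N); apply: pole_order_ext pole_x => x z xz.
    by rewrite -(Xc x z) // -(Zc x z) // X'K.
  case: (constP f'.[c] (d + d.+1)%N).
  apply: pole_order_ext (pole_orderM size_f pZ pZ) => x z xz.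
  by rewrite -expr2 onXZ // Xc.
have f'0 : f' != 0 by rewrite -size_poly_gt0 size_f'.
have := pole_order_poly size_f pX f'0; rewrite size_f' => pfX.
case: (regular_const_or_pole size_f regZ) => [[c' Zc]|[d' pZ]].
  case: (constP (c' ^+ 2) (2 + 3 * d)%N).
  rewrite (_ : (_ + _).+1 = (4.-1 * d.+1)%N); last lia.
  by apply: pole_order_ext pfX => x z xz; rewrite -onXZ // Zc.
have pZZ : pole_order f (fun x z => f'.[X x z]) (d'.+1 + d'.+1).
  apply: pole_order_ext (pole_orderM size_f pZ pZ) => x z xz.
  by rewrite -expr2 onXZ.
have /= dd' := pole_order_uniq size_f pfX pZZ.
exists (d' - d).-1; rewrite (_ : (2 * _)%N = d.+1); last lia.
by rewrite (_ : (3 * _)%N = d'.+1) //; lia.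
Qed.

Hypothesis two_neq0 : 2%:R != 0 :> K.
Hypothesis lead_ff' : lead_coef f = lead_coef f'.

(** The pole orders 2 of x and 3 of z are multiples of the constant of
    [pole_orders_affine_iso], which is therefore 1.  So X = a(x) with a
    linear and Z = c(x) + g z; comparing the terms in z in Z^2 = f'(X) gives
    c = 0, and comparing leading coefficients gives g^2 = lead(a)^3, so that
    u = g / lead(a). *)
Lemma affine_iso : exists u r, u != 0 /\ forall x z, z ^+ 2 = f.[x] ->
  X x z = u ^+ 2 * x + r /\ Z x z = u ^+ 3 * z.
Proof.
have [k [pX pZ]] := pole_orders_affine_iso.
have dvd_k g g' d : regular f' g' ->
    (forall x z, z ^+ 2 = f.[x] -> g' (X x z) (Z x z) = g x z) ->
    pole_order f g d.+1 -> (k.+1 %| d.+1)%N.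
  move=> [h g'h] gg' pg.
  have {gg'} gh x z : z ^+ 2 = f.[x] -> g x z = ev h (X x z) (Z x z).
    by move=> xz; rewrite -gg' // g'h ?onXZ.
  have [h0|h0] := eqVneq h (0, 0).
    case: (@not_pole_order_const _ _ size_f 0 d).
    apply: pole_order_ext pg => x z xz.
    by rewrite gh // h0 /ev /= !horner0 mul0r addr0.
  have ph : pole_order f g (k.+1 * (sz (norm f' h)).-1).
    by apply: pole_order_ext (pole_order_pullback pX pZ h0) => x z /gh.
  by rewrite (pole_order_uniq size_f pg ph) dvdn_mulr.
have k2 := dvd_k _ _ _ regX' X'K pole_x.
have k3 := dvd_k _ _ _ regZ' Z'K pole_z.
have k0 : k = 0%N.
  have : (k.+1 %| gcdn 2 3)%N by rewrite dvdn_gcd k2 k3.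
  by rewrite dvdn1 => /eqP [].
move: pX pZ; rewrite k0 !muln1 {k k0 k2 k3 dvd_k} => -[[a b] /= Xab].
rewrite (size_norm size_f) /=; have [b0 sa|b0 sa] := eqVneq b 0; last first.
  have sb : (0 < sz b)%N by rewrite size_poly_gt0.
  lia.
case=> -[c d] /= Zcd.
rewrite (size_norm size_f) /=; have [d0 sc|d0 sc] := eqVneq d 0; first lia.
have sd : (0 < sz d)%N by rewrite size_poly_gt0.
have sd1 : sz d == 1%N by lia.
have/size_poly1P [g g0 dg] := sd1.
have sa2 : sz a = 2%N by lia.
have curve x z : z ^+ 2 = f.[x] ->
    ev (c ^+ 2 + f * d ^+ 2, 2%:R *: (c * d)) x z = ev (f' \Po a, 0) x z.
  move=> xz; move: (onXZ xz); rewrite Xab // Zcd // b0 /ev /=.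
  rewrite !(hornerE, horner_exp, horner_comp) /= => <-; rewrite -xz.
  by ring.
have [] := ev_inj size_f curve; move=> fc /eqP.
rewrite scaler_eq0 (negPf two_neq0) mulf_eq0 (negPf d0) orbF => /eqP c0.
move: fc; rewrite c0 expr0n add0r dg -polyC_exp => /(congr1 lead_coef).
rewrite lead_coef_comp ?sa2 // lead_coefM lead_coefC size_f' lead_ff' /=.
have l0 : lead_coef f' != 0 by rewrite lead_coef_eq0 -size_poly_eq0 size_f'.
move/(mulfI l0) => gl.
have l1 : lead_coef a != 0 by rewrite lead_coef_eq0 -size_poly_eq0 sa2.
have aE x : a.[x] = lead_coef a * x + a`_0.
  rewrite horner_coef sa2 big_ord_recl big_ord1 /= expr0 expr1 mulr1 addrC.
  by rewrite lead_coefE sa2.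
exists (g / lead_coef a), a`_0; split; first by rewrite mulf_neq0 ?invr_eq0.
have u2 : (g / lead_coef a) ^+ 2 = lead_coef a.
  by rewrite expr_div_n gl exprS mulfK ?expf_neq0.
move=> x z xz; rewrite (exprSr _ 2) u2 Xab // Zcd // b0 c0 dg /ev /= !hornerE
  /=.
by rewrite aE [lead_coef a * g]mulrC mulfK.
Qed.

End AffineIso.

(** * Cardinals of images *)

Lemma card_image_seq (T : eqType) (U : Type) (f : T -> U) (s : seq T) (x0 : T) :
  uniq s -> {in s &, injective f} ->
  [set f x | x in [set x | x \in s]] #= `I_(size s).
Proof.
move=> us inj_f.
have -> : [set f x | x in [set x | x \in s]] =
    [set f (nth x0 s k) | k in `I_(size s)].
  apply/seteqP; split=> _ [x xs <-].
    by exists (index x s); rewrite /= ?index_mem ?nth_index.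
  by exists (nth x0 s x) => //; apply: mem_nth.
apply: inj_card_eq => j k /set_mem/= js /set_mem/= ks fjk.
by apply/eqP; rewrite -(nth_uniq x0 js ks us); apply/eqP/inj_f;
  rewrite ?mem_nth.
Qed.

(** Both images are the quotient of S by the same equivalence relation. *)
Lemma card_image_eq (T U V : Type) (S : set T) (f : T -> U) (g : T -> V)
    (u0 : U) :
  (forall x y, S x -> S y -> f x = f y <-> g x = g y) ->
  [set f x | x in S] #= [set g x | x in S].
Proof.
move=> fg.
pose h v := if pselect (exists2 x, S x & g x = v) is left e
            then f (projT1 (cid2 e)) else u0.
have hg x : S x -> h (g x) = f x.
  move=> Sx; rewrite /h; case: pselect => [e|[]]; last by exists x.
  by case: cid2 => y Sy gy /=; apply/fg.
have -> : [set f x | x in S] = [set h v | v in [set g x | x in S]].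
  apply/seteqP; split=> _ [x Sx <-]; first by exists (g x);
    [exists x|apply: hg].
  by case: Sx => y Sy <-; exists y; rewrite ?hg.
apply: inj_card_eq => _ _ /set_mem[x Sx <-] /set_mem[y Sy <-].
by rewrite !hg // => /fg; apply.
Qed.

(** * Points in the coordinates (x, z) *)

Section EllipticCurves.
Variable K : closedFieldType.
Hypothesis char3 : 3%N \in [pchar K].
Implicit Types (E : weierstrass K) (L : {pred K}) (a b c r s t u v w x : K).

Let three0 : 3%:R = 0 :> K := pcharf0 char3.

Lemma two_neq0 : 2%:R != 0 :> K.
Proof.
apply/eqP => two0; have := three0; rewrite (natrD _ 1 2) two0 addr0.
by apply/eqP; rewrite oner_neq0.
Qed.

Lemma eq_char3 (a b c : K) : a - b = 3%:R * c -> a = b.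
Proof. by rewrite three0 mul0r => /eqP; rewrite subr_eq0 => /eqP. Qed.

(** In characteristic 3 this is 2 y + a1 x + a3, the coordinate that completes
    the square. *)
Definition zcoord E (x y : K) := a1 E * x + a3 E - y.

Definition cubic E : {poly K} := Poly [:: b6 E; - b4 E; b2 E; 1].

Lemma cubicE E x :
  (cubic E).[x] = x ^+ 3 + b2 E * x ^+ 2 - b4 E * x + b6 E.
Proof. by rewrite horner_Poly /=; ring. Qed.

Lemma polyseq_cubic E : cubic E = [:: b6 E; - b4 E; b2 E; 1] :> seq K.
Proof. by rewrite /cubic (PolyK (c := 1)) //= oner_eq0. Qed.

Lemma size_cubic E : size (cubic E) = 4%N.
Proof. by rewrite polyseq_cubic. Qed.

Lemma lead_coef_cubic E : lead_coef (cubic E) = 1.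
Proof. by rewrite lead_coefE size_cubic polyseq_cubic. Qed.

(** The two equations differ by 3 times a polynomial. *)
Lemma on_curveE E x y :
  on_curve E (Affine x y) = (zcoord E x y ^+ 2 == (cubic E).[x]).
Proof.
rewrite /on_curve cubicE /zcoord /b2 /b4 /b6 -subr_eq0 -[RHS]subr_eq0.
congr (_ == 0); apply: (@eq_char3 _ _ (a1 E * x * y + a3 E * y
  + a2 E * x ^+ 2 - (a4 E + a1 E * a3 E) * x + a6 E)).
by ring.
Qed.

(** Off the curve the origin serves as a default value. *)
Definition mkpt E (x z : K) : point E :=
  insubd (Opt E) (Affine x (a1 E * x + a3 E - z)).

Lemma mkptE E x z : z ^+ 2 = (cubic E).[x] ->
  mkpt E x z = Affine x (a1 E * x + a3 E - z) :> ppoint K.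
Proof.
move=> xz; apply: insubdK.
suff : on_curve E (Affine x (a1 E * x + a3 E - z)) by [].
rewrite on_curveE /zcoord; apply/eqP; rewrite -xz; congr (_ ^+ 2); ring.
Qed.

Lemma point_inj E (P Q : point E) : P = Q :> ppoint K -> P = Q.
Proof. exact: val_inj. Qed.

Lemma point_ind E (R : point E -> Prop) : R (Opt E) ->
  (forall x z, z ^+ 2 = (cubic E).[x] -> R (mkpt E x z)) -> forall P, R P.
Proof.
move=> R0 Raff P; case EP: (pt P) => [|x y].
  by rewrite (_ : P = Opt E) //; apply: point_inj.
have /eqP xz : zcoord E x y ^+ 2 == (cubic E).[x].
  by rewrite -on_curveE -EP; case: (P).
rewrite (_ : P = mkpt E x (zcoord E x y)); first exact: Raff.
by apply: point_inj; rewrite EP mkptE // /zcoord; congr Affine; ring.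
Qed.

Lemma mkpt_inj E x z x' z' :
  z ^+ 2 = (cubic E).[x] -> z' ^+ 2 = (cubic E).[x'] ->
  mkpt E x z = mkpt E x' z' -> x = x' /\ z = z'.
Proof.
move=> xz xz' /(congr1 (@pt K E)); rewrite !mkptE // => -[<- /addrI/oppr_inj].
by [].
Qed.

Lemma mkpt_neqO E x z : z ^+ 2 = (cubic E).[x] -> mkpt E x z <> Opt E.
Proof. by move=> xz /(congr1 (@pt K E)); rewrite mkptE. Qed.

Definition xcoo E (P : point E) : K := if pt P is Affine x y then x else 0.
Definition zcoo E (P : point E) : K :=
  if pt P is Affine x y then zcoord E x y else 0.

Lemma xcoo_mkpt E x z : z ^+ 2 = (cubic E).[x] -> xcoo (mkpt E x z) = x.
Proof. by move=> xz; rewrite /xcoo mkptE. Qed.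

Lemma zcoo_mkpt E x z : z ^+ 2 = (cubic E).[x] -> zcoo (mkpt E x z) = z.
Proof. by move=> xz; rewrite /zcoo mkptE // /zcoord; ring. Qed.

Lemma mkpt_coo E (P : point E) : P <> Opt E -> P = mkpt E (xcoo P) (zcoo P).
Proof.
elim/point_ind: P => // x z xz _.
by rewrite xcoo_mkpt // zcoo_mkpt.
Qed.

Lemma coo_curve E (P : point E) :
  P <> Opt E -> zcoo P ^+ 2 = (cubic E).[xcoo P].
Proof.
elim/point_ind: P => // x z xz _.
by rewrite xcoo_mkpt // zcoo_mkpt.
Qed.

(** * The maps (x, z) |-> (u^2 x + r, u^3 z) *)

Definition curve_iso E E' (u r : K) : Prop :=
  u != 0 /\ forall x, u ^+ 6 * (cubic E).[x] = (cubic E').[u ^+ 2 * x + r].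

Definition scalept E E' (u r : K) (P : point E) : point E' :=
  if pt P is Affine x y then mkpt E' (u ^+ 2 * x + r) (u ^+ 3 * zcoord E x y)
  else Opt E'.

Lemma curve_iso_on E E' u r x z : curve_iso E E' u r ->
  z ^+ 2 = (cubic E).[x] -> (u ^+ 3 * z) ^+ 2 = (cubic E').[u ^+ 2 * x + r].
Proof. by move=> [_ <-] <-; ring. Qed.

Lemma scalept_O E E' u r : scalept E' u r (Opt E) = Opt E'.
Proof. by []. Qed.

Lemma scalept_mkpt E E' u r x z : z ^+ 2 = (cubic E).[x] ->
  scalept E' u r (mkpt E x z) = mkpt E' (u ^+ 2 * x + r) (u ^+ 3 * z).
Proof.
by move=> xz; rewrite /scalept mkptE //; congr (mkpt _ _ (_ * _));
  rewrite /zcoord; ring.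
Qed.

Lemma curve_iso_comp E E' E'' u r u' r' :
  curve_iso E E' u r -> curve_iso E' E'' u' r' ->
  curve_iso E E'' (u' * u) (u' ^+ 2 * r + r').
Proof.
move=> [u0 cu] [u'0 cu']; split; first by rewrite mulf_neq0.
move=> x; rewrite exprMn -mulrA cu cu'; congr _.[_]; ring.
Qed.

Lemma curve_iso_inv E E' u r :
  curve_iso E E' u r -> curve_iso E' E u^-1 (- r / u ^+ 2).
Proof.
move=> [u0 cu]; split; first by rewrite invr_eq0.
move=> x; have u60 : u ^+ 6 != 0 by rewrite expf_neq0.
apply: (mulfI u60); rewrite cu exprVn mulrA mulfV // mul1r; congr _.[_].
by field.
Qed.

Lemma curve_iso_id E : curve_iso E E 1 0.
Proof. by split=> [|x]; rewrite ?oner_neq0 // !expr1n !mul1r addr0. Qed.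

Lemma scalept_comp E E' E'' u r u' r' (P : point E) : curve_iso E E' u r ->
  scalept E'' u' r' (scalept E' u r P)
    = scalept E'' (u' * u) (u' ^+ 2 * r + r') P.
Proof.
move=> c; elim/point_ind: P => [|x z xz]; first by rewrite !scalept_O.
rewrite !scalept_mkpt //; last exact: (curve_iso_on c xz).
by congr mkpt; ring.
Qed.

Lemma scalept_id E (P : point E) : scalept E 1 0 P = P.
Proof.
elim/point_ind: P => [|x z xz] //; rewrite scalept_mkpt //.
by congr mkpt; ring.
Qed.

Lemma scalept_inv E E' u r : curve_iso E E' u r ->
  is_inverse (@scalept E E' u r) (@scalept E' E u^-1 (- r / u ^+ 2)).
Proof.
move=> c; have [u0 _] := c; split=> P.
  rewrite scalept_comp // mulVf // (_ : _ + _ = 0) ?scalept_id //.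
  by field.
rewrite scalept_comp; last exact: curve_iso_inv.
by rewrite divff // (_ : _ + _ = 0) ?scalept_id //; field.
Qed.

(** The ratio of u^3 and u^2 recovers u; the value of u^3 is read off at a
    point with z != 0. *)
Lemma scalept_param_inj E E' u r u' r' :
  curve_iso E E' u r -> curve_iso E E' u' r' ->
  (forall P : point E, scalept E' u r P = scalept E' u' r' P) ->
  u = u' /\ r = r'.
Proof.
move=> c c' eqs.
have eqsx x z : z ^+ 2 = (cubic E).[x] ->
    u ^+ 2 * x + r = u' ^+ 2 * x + r' /\ u ^+ 3 * z = u' ^+ 3 * z.
  move=> xz; have := eqs (mkpt E x z); rewrite !scalept_mkpt //.
  by apply: mkpt_inj; [exact: curve_iso_on c xz|exact: curve_iso_on c' xz].
have eqx x : u ^+ 2 * x + r = u' ^+ 2 * x + r'.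
  by have [z xz] := sqrt_exists (cubic E).[x]; have [] := eqsx _ _ xz.
have rr' : r = r' by have := eqx 0; rewrite !mulr0 !add0r.
have u2 : u ^+ 2 = u' ^+ 2 by have := eqx 1; rewrite !mulr1 rr' => /addIr.
have [x fx0] : exists x, (cubic E).[x] != 0.
  apply: contrapT => nox; have : cubic E = 0.
    apply: poly_eq0_horner => x; apply/eqP/negPn/negP => x0.
    by apply: nox; exists x.
  by move/eqP; rewrite -size_poly_eq0 size_cubic.
have [z xz] := sqrt_exists (cubic E).[x].
have z0 : z != 0 by apply: contraNneq fx0 => z0; rewrite -xz z0 expr0n.
have [_ /(mulIf z0)] := eqsx _ _ xz; rewrite 2!exprSr [in RHS]exprSr => u3.
have u0 : u ^+ 2 != 0 by rewrite expf_neq0 ?c.1.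
split=> //; apply: (mulfI u0); move: u3.
by rewrite -!exprSr => ->; rewrite u2 -exprSr.
Qed.

(** * Isomorphisms are affine substitutions *)

Let j0 : 'I_3 := @Ordinal 3 0 isT.
Let j1 : 'I_3 := @Ordinal 3 1 isT.
Let j2 : 'I_3 := @Ordinal 3 2 isT.

Lemma ord3P (i : 'I_3) : [\/ i = j0, i = j1 | i = j2].
Proof.
case: i => [[|[|[|//]]] lti]; [apply: Or31|apply: Or32|apply: Or33];
  exact: val_inj.
Qed.

Lemma regular_form E (p : {mpoly K[3]}) : regular (cubic E)
  (fun x z => p.@[hcoord (Affine x (a1 E * x + a3 E - z))]).
Proof.
have regC c : regular (cubic E) (fun _ _ => c).
  by apply: regular_ext (regular_poly _ c%:P) => x z _; rewrite hornerC.
have regX i : regular (cubic E)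
    (fun x z => hcoord (Affine x (a1 E * x + a3 E - z)) i).
  have [->|->|->] := ord3P i; last exact: regC.
    by apply: regular_ext (regular_poly _ 'X) => x z _; rewrite hornerX.
  exists ((a1 E)%:P * 'X + (a3 E)%:P, (-1)%:P) => x z _.
  by rewrite /ev /hcoord /= !hornerE mulN1r.
have regXn i m : regular (cubic E)
    (fun x z => hcoord (Affine x (a1 E * x + a3 E - z)) i ^+ m).
  elim: m => [|m IHm]; first exact: regC.
  by apply: regular_ext (regularM (regX i) IHm) => x z _; rewrite exprS.
have regm m : regular (cubic E)
    (fun x z => \prod_i hcoord (Affine x (a1 E * x + a3 E - z)) i ^+ m i).
  apply: regular_ext
    (regularM (regularM (regXn j0 (m j0)) (regXn j1 (m j1))) (regXn j2 (m j2))).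
  move=> x z _; rewrite !big_ord_recl big_ord0 mulr1 mulrA.
  by congr (_ * _ * _); congr (_ ^+ m _); apply: val_inj.
suff [h hP] : regular (cubic E) (fun x z => \sum_(m <- msupp p)
    p@_m * \prod_i hcoord (Affine x (a1 E * x + a3 E - z)) i ^+ m i).
  by exists h => x z xz; rewrite mevalE hP.
elim: (msupp p) => [|m s IHs].
  by apply: regular_ext (regC 0) => x z _; rewrite big_nil.
apply: regular_ext (regularD (regularM (regC p@_m) (regm m)) IHs) => x z _.
by rewrite big_cons.
Qed.

Lemma hcoord_coo E (P : point E) : P <> Opt E ->
  [/\ hcoord P j0 = xcoo P, hcoord P j2 = 1 &
      zcoo P = a1 E * hcoord P j0 + a3 E - hcoord P j1].
Proof. by case: P => -[|x y] // EP; case; apply: point_inj. Qed.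

(** If forms F represent phi near a point, then F_2 x(phi) = F_0 on the whole
    affine curve: where F does not vanish this is the definition, and elsewhere
    both sides are 0.  So F_2 is a denominator that is invertible at the
    point. *)
Lemma morphism_regular L E E' (phi : point E -> point E') :
  is_morphism L phi -> (forall P, P <> Opt E -> phi P <> Opt E') ->
  regular (cubic E) (fun x z => xcoo (phi (mkpt E x z))) /\
  regular (cubic E) (fun x z => zcoo (phi (mkpt E x z))).
Proof.
move=> mphi phiO.
have key x z : z ^+ 2 = (cubic E).[x] -> exists h g0 g1,
   [/\ regular (cubic E) g0, regular (cubic E) g1, ev h x z != 0 &
    forall x' z', z' ^+ 2 = (cubic E).[x'] ->
      xcoo (phi (mkpt E x' z')) * ev h x' z' = g0 x' z' /\
      zcoo (phi (mkpt E x' z')) * ev h x' z' = g1 x' z'].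
  move=> xz; have [d [F [_ defF repF]]] := mphi (mkpt E x z).
  pose G i (x z : K) := (F i).@[hcoord (Affine x (a1 E * x + a3 E - z))].
  have regG i : regular (cubic E) (G i) := regular_form E (F i).
  have [h Gh] := regG j2.
  have FG i x' z' : z' ^+ 2 = (cubic E).[x'] ->
      (F i).@[hcoord (mkpt E x' z')] = G i x' z'.
    by move=> xz'; rewrite mkptE.
  have defE x' z' : z' ^+ 2 = (cubic E).[x'] -> defined_at F (mkpt E x' z') ->
      exists c, [/\ c * G j2 x' z' = 1,
        xcoo (phi (mkpt E x' z')) = c * G j0 x' z' &
        zcoo (phi (mkpt E x' z')) = a1 E' * (c * G j0 x' z')
           + a3 E' - c * G j1 x' z'].
    move=> xz' /repF[c c0 hF]; exists c.
    have [h0 h2 ->] := hcoord_coo (phiO _ (mkpt_neqO xz')).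
    by rewrite -h2 -h0 !hF !FG.
  exists h, (G j0), (fun x z => a1 E' * G j0 x z + a3 E' * G j2 x z
                                - G j1 x z).
  split.
  - exact: regG.
  - have regC c : regular (cubic E) (fun _ _ => c).
      by apply: regular_ext (regular_poly _ c%:P) => x1 z1 _; rewrite hornerC.
    apply: regular_ext (regularD (regularD (regularM (regC (a1 E')) (regG j0))
      (regularM (regC (a3 E')) (regG j2))) (regularM (regC (-1)) (regG j1))).
    by move=> x1 z1 _; rewrite mulN1r.
  - have [c [c1 _ _]] := defE _ _ xz defF.
    rewrite -Gh //; apply/eqP => G0; move: c1.
    by rewrite G0 mulr0 => /eqP; rewrite eq_sym oner_eq0.
  move=> x' z' xz'; rewrite -Gh //.
  case: (pselect (defined_at F (mkpt E x' z'))) => [dF|ndF].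
    have [c [c1 -> ->]] := defE _ _ xz' dF.
    rewrite mulrAC c1 mul1r; split=> //.
    transitivity (a1 E' * G j0 x' z' * (c * G j2 x' z') + a3 E' * G j2 x' z'
                  - G j1 x' z' * (c * G j2 x' z')); first by ring.
    by rewrite c1 !mulr1.
  have G0 i : G i x' z' = 0.
    apply/eqP; apply: contrapT => /negP Gi; apply: ndF; exists i.
    by rewrite FG.
  by rewrite !G0; split; ring.
split; apply: regular_local => x z /key
  [h [g0 [g1 [r0 r1 hxz hg]]]]; exists h; split=> //.
  by apply: regular_ext r0 => x' z' /hg [].
by apply: regular_ext r1 => x' z' /hg [].
Qed.

(** An isomorphism and its inverse fix the origins, hence exchange the affine
    parts, and their coordinates there are regular: this is the situation of
    [affine_iso]. *)
Lemma is_iso_scalept L E E' (phi : point E -> point E') : is_iso L phi ->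
  exists u r, curve_iso E E' u r /\ phi = @scalept E E' u r.
Proof.
move=> [mphi phiO [psi [mpsi phiK psiK]]].
have psiO : psi (Opt E') = Opt E by rewrite -phiO phiK.
have phiN P : P <> Opt E -> phi P <> Opt E'.
  by move=> PO phiPO; apply: PO; rewrite -(phiK P) phiPO.
have psiN P : P <> Opt E' -> psi P <> Opt E.
  by move=> PO psiPO; apply: PO; rewrite -(psiK P) psiPO.
have [rX rZ] := morphism_regular mphi phiN.
have [rX' rZ'] := morphism_regular mpsi psiN.
have phi_mk x z : z ^+ 2 = (cubic E).[x] -> phi (mkpt E x z) =
    mkpt E' (xcoo (phi (mkpt E x z))) (zcoo (phi (mkpt E x z))).
  by move=> xz; apply/mkpt_coo/phiN/mkpt_neqO.
have onE x z : z ^+ 2 = (cubic E).[x] ->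
    zcoo (phi (mkpt E x z)) ^+ 2 = (cubic E').[xcoo (phi (mkpt E x z))].
  by move=> xz; apply/coo_curve/phiN/mkpt_neqO.
have XK x z : z ^+ 2 = (cubic E).[x] ->
    xcoo (psi (mkpt E' (xcoo (phi (mkpt E x z))) (zcoo (phi (mkpt E x z))))) =
      x.
  by move=> xz; rewrite -phi_mk // phiK xcoo_mkpt.
have ZK x z : z ^+ 2 = (cubic E).[x] ->
    zcoo (psi (mkpt E' (xcoo (phi (mkpt E x z))) (zcoo (phi (mkpt E x z))))) =
      z.
  by move=> xz; rewrite -phi_mk // phiK zcoo_mkpt.
have lead_EE' : lead_coef (cubic E) = lead_coef (cubic E').
  by rewrite !lead_coef_cubic.
have [u [r [u0 ur]]] := affine_iso (size_cubic E) (size_cubic E') rX rZ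
   rX' rZ' onE XK ZK two_neq0 lead_EE'.
exists u, r; split; last first.
  apply: funext; apply: point_ind => [|x z xz]; first by rewrite phiO.
  by rewrite phi_mk // scalept_mkpt //; have [-> ->] := ur _ _ xz.
split=> // x; have [z xz] := sqrt_exists (cubic E).[x].
have := onE _ _ xz; have [-> ->] := ur _ _ xz => <-.
by rewrite -xz; ring.
Qed.

(** * Linear forms *)

Definition linform (c0 c1 c2 : K) : {mpoly K[3]} :=
  c0 *: 'X_j0 + c1 *: 'X_j1 + c2 *: 'X_j2.

Lemma linform_eval c0 c1 c2 (v : 'I_3 -> K) :
  (linform c0 c1 c2).@[v] = c0 * v j0 + c1 * v j1 + c2 * v j2.
Proof. by rewrite /linform !mevalD !mevalZ !mevalXU. Qed.

Lemma linform_homog c0 c1 c2 : linform c0 c1 c2 \is 1.-homog.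
Proof.
have hX (i : 'I_3) c : c *: 'X_i \is [in K[3], 1.-homog].
  by apply: dhomogZ; rewrite dhomogX /= mdeg1.
by rewrite /linform; do 2?[apply: dhomogD]; apply: hX.
Qed.

Lemma linform_over L c0 c1 c2 : 0 \in L -> c0 \in L -> c1 \in L -> c2 \in L ->
  linform c0 c1 c2 \is a mpolyOver 3 L.
Proof.
move=> L0 Lc0 Lc1 Lc2; apply/allP => c /mapP [m _ ->].
rewrite /linform !mcoeffD !mcoeffZ !mcoeffX.
have [<-|n0] := eqVneq U_(j0)%MM m.
  by rewrite !eq_mnm1 /= mulr1 !mulr0 !addr0.
have [<-|n1] := eqVneq U_(j1)%MM m.
  by rewrite !eq_mnm1 /= mulr1 !mulr0 addr0 add0r.
by case: (_ == m); rewrite ?mulr1 !mulr0 ?addr0 ?add0r.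
Qed.

(** * Fields of definition *)

Definition coefs_in L E : Prop :=
  [/\ a1 E \in L, a2 E \in L, a3 E \in L, a4 E \in L & a6 E \in L].

(** The substitution is linear in the coordinates (x, y), so a single triple
    of linear forms, without common zero on the curve, represents it. *)
Lemma scalept_morphism L E E' u r : GRing.divring_closed L ->
  coefs_in L E -> coefs_in L E' -> u \in L -> r \in L -> curve_iso E E' u r ->
  is_morphism L (@scalept E E' u r).
Proof.
move=> closedL.
pose LS : divringClosed K :=
  HB.pack L (GRing.isDivringClosed.Build K L closedL).
suff : coefs_in LS E -> coefs_in LS E' -> u \in LS -> r \in LS -> curve_iso E
  E' u r ->
  is_morphism LS (@scalept E E' u r) by [].
move=> [La1 _ La3 _ _] [La1' _ La3' _ _] Lu Lr c P; exists 1%N.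
pose s := a1 E' * u ^+ 2 - u ^+ 3 * a1 E.
pose t := a1 E' * r + a3 E' - u ^+ 3 * a3 E.
pose F (i : 'I_3) := nth 0 [:: linform (u ^+ 2) 0 r; linform s (u ^+ 3) t;
                             linform 0 0 1] i.
have u30 : u ^+ 3 != 0 by rewrite expf_neq0 ?c.1.
have Faff i x z : z ^+ 2 = (cubic E).[x] -> (F i).@[hcoord (mkpt E x z)]
    = hcoord (scalept E' u r (mkpt E x z)) i.
  move=> xz; rewrite scalept_mkpt // !mkptE //; last exact: curve_iso_on xz.
  by have [->|->|->] := ord3P i; rewrite linform_eval /hcoord /= /s /t; ring.
have FO i : (F i).@[hcoord (Opt E)] = u ^+ 3 * hcoord (Opt E') i.
  by have [->|->|->] := ord3P i; rewrite linform_eval /hcoord /=; ring.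
exists F; split.
- move=> i; split.
    by have [->|->|->] := ord3P i; apply: linform_homog.
  by have [->|->|->] := ord3P i; apply: linform_over;
    rewrite ?(rpred0, rpred1, rpredB, rpredD, rpredM, rpredX).
- elim/point_ind: P => [|x z xz]; first by exists j1; rewrite FO mulr1.
  exists j2; rewrite Faff // scalept_mkpt // mkptE ?oner_neq0 //.
  exact: curve_iso_on xz.
- elim/point_ind => [|x z xz] _.
    exists (u ^+ 3)^-1; first by rewrite invr_eq0.
    by move=> i; rewrite FO mulKf.
  by exists 1; rewrite ?oner_neq0 // => i; rewrite Faff // mul1r.
Qed.

Lemma scalept_is_iso L E E' u r : GRing.divring_closed L ->
  coefs_in L E -> coefs_in L E' -> u \in L -> r \in L -> curve_iso E E' u r ->
  is_iso L (@scalept E E' u r).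
Proof.
move=> closedL LE LE' Lu Lr c; split=> //; first exact: scalept_morphism.
exists (@scalept E' E u^-1 (- r / u ^+ 2)).
have [sK Ks] := scalept_inv c; split=> //.
apply: scalept_morphism => //; last exact: curve_iso_inv.
  pose LS : divringClosed K :=
    HB.pack L (GRing.isDivringClosed.Build K L closedL).
  by suff: u^-1 \in LS by []; rewrite rpredV.
pose LS : divringClosed K :=
  HB.pack L (GRing.isDivringClosed.Build K L closedL).
suff: - r / u ^+ 2 \in LS by [].
by rewrite rpred_div ?rpredN ?rpredX.
Qed.

Lemma divring_closedT : GRing.divring_closed (predT : {pred K}).
Proof. by split. Qed.

Lemma is_isoT E E' (phi : point E -> point E') :
  is_iso predT phi <->
  exists u r, curve_iso E E' u r /\ phi = @scalept E E' u r.
Proof.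
split; first exact: is_iso_scalept.
move=> [u [r [c ->]]]; apply: scalept_is_iso => //; exact: divring_closedT.
Qed.

(** * The action of Frobenius *)

Section Frob.
Variable m : nat.
Local Notation q := (3 ^ m)%N.

Definition frob (x : K) : K := x ^+ q.

Fact frob_is_additive : zmod_morphism frob.
Proof.
have q_nat : [pchar K].-nat q by rewrite pnatX (eq_pnat _ (pcharf_eq char3))
  pnat_id.
move=> x y; rewrite /frob exprDn_pchar //; congr (_ + _).
have N1 : (-1) ^+ q = -1 :> K by rewrite -signr_odd oddX orbT expr1.
by rewrite -mulN1r exprMn N1 mulN1r.
Qed.

Fact frob_is_monoid_morphism : monoid_morphism frob.
Proof. by split=> [|x y]; rewrite /frob ?expr1n ?exprMn. Qed.

(** Additivity depends on the hypothesis on the characteristic, so this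
    morphism cannot be found by canonical structure inference. *)
Definition frobR : {rmorphism K -> K} :=
  HB.pack_for {rmorphism K -> K} frob
    (GRing.isZmodMorphism.Build K K frob frob_is_additive)
    (GRing.isMonoidMorphism.Build K K frob frob_is_monoid_morphism).

Lemma frobRE x : frobR x = x ^+ q.
Proof. by []. Qed.

Lemma Fq_closed : GRing.divring_closed (Fq K q).
Proof.
split=> [|x y /eqP xq /eqP yq|x y /eqP xq /eqP yq].
- by rewrite unfold_in /= expr1n.
- apply/eqP; have := rmorphB frobR x y; rewrite !frobRE => ->.
  by rewrite xq yq.
- by apply/eqP; rewrite expr_div_n xq yq.
Qed.

Lemma frob_surj (y : K) : exists x, x ^+ q = y.
Proof.
have q0 : (0 < q)%N by rewrite expn_gt0.
have /closed_rootP [x] : size ('X^q - y%:P)%R != 1%N.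
  by rewrite size_XnsubC // eqSS -lt0n.
by rewrite /root !hornerE subr_eq0 => /eqP; exists x.
Qed.

Lemma frob_cubic E x : coefs_in (Fq K q) E ->
  (cubic E).[x] ^+ q = (cubic E).[x ^+ q].
Proof.
move=> [/eqP f1 /eqP f2 /eqP f3 /eqP f4 /eqP f6]; rewrite -!frobRE !cubicE.
rewrite -!frobRE in f1 f2 f3 f4 f6; rewrite /b2 /b4 /b6.
rewrite !(rmorphD, rmorphB, rmorphN, rmorphM, rmorphXn, rmorph_nat).
by rewrite f1 f2 f3 f4 f6 rmorph1; ring.
Qed.

Definition frobpt E (P : point E) : point E :=
  if pt P is Affine x y then mkpt E (x ^+ q) (zcoord E x y ^+ q) else Opt E.

Lemma frobpt_mkpt E x z : z ^+ 2 = (cubic E).[x] ->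
  frobpt (mkpt E x z) = mkpt E (x ^+ q) (z ^+ q).
Proof.
by move=> xz; rewrite /frobpt mkptE //; congr (mkpt _ _ (_ ^+ _));
  rewrite /zcoord; ring.
Qed.

Lemma frob_on E x z : coefs_in (Fq K q) E ->
  z ^+ 2 = (cubic E).[x] -> (z ^+ q) ^+ 2 = (cubic E).[x ^+ q].
Proof. by move=> oE xz; rewrite exprAC xz frob_cubic. Qed.

Lemma frobpt_surj E (Q : point E) : coefs_in (Fq K q) E -> exists P, frobpt P =
  Q.
Proof.
move=> oE; elim/point_ind: Q => [|x z xz]; first by exists (Opt E).
have [x' x'E] := frob_surj x; have [z' z'E] := frob_surj z.
have xz' : z' ^+ 2 = (cubic E).[x'].
  apply: (fmorph_inj frobR); rewrite !frobRE frob_cubic // x'E -xz -z'E.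
  by rewrite exprAC.
by exists (mkpt E x' z'); rewrite frobpt_mkpt // x'E z'E.
Qed.

Lemma hcoord_frobpt E (P : point E) i : coefs_in (Fq K q) E ->
  hcoord (frobpt P) i = hcoord P i ^+ q.
Proof.
move=> oE; have q0 : (0 < q)%N by rewrite expn_gt0.
have e0 : 0 ^+ q = 0 :> K by rewrite expr0n gtn_eqF.
elim/point_ind: P => [|x z xz].
  by have [->|->|->] := ord3P i; rewrite /hcoord /= ?expr1n ?e0.
rewrite frobpt_mkpt // !mkptE //; last exact: frob_on xz.
have [->|->|->] := ord3P i; rewrite /hcoord /= ?expr1n //.
case: oE => /eqP f1 _ /eqP f3 _ _; rewrite -!frobRE rmorphB rmorphD rmorphM /=.
by rewrite /frob f1 f3.
Qed.

Lemma hcoord_prop E (P Q : point E) c : c != 0 ->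
  (forall i, hcoord P i = c * hcoord Q i) -> P = Q.
Proof.
case: P Q => [[|x y] oP] [[|x' y'] oQ] c0 PQ; apply: point_inj => /=.
- by [].
- have /eqP := PQ j2; rewrite /hcoord /= eq_sym mulr1.
  by rewrite (negPf c0).
- have /eqP := PQ j2; rewrite /hcoord /= mulr0 oner_eq0 //.
- have := PQ j2; rewrite /hcoord /= mulr1 => c1.
  by have := PQ j0; have := PQ j1; rewrite /hcoord /= -c1 !mul1r => -> ->.
Qed.

Lemma frob_form_eval (p : {mpoly K[3]}) (v w : 'I_3 -> K) :
  (forall i, w i = v i ^+ q) ->
  (map_mpoly (fun x : K => x ^+ q) p).@[w] = p.@[v] ^+ q.
Proof.
move=> vw; rewrite -[RHS]frobRE [p.@[v]]mevalE rmorph_sum.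
rewrite /map_mpoly /mmap rmorph_sum; apply: eq_bigr => mm _ /=.
rewrite mevalM mevalC mmap1_id mevalX -[RHS]frobRE rmorphM rmorph_prod.
by congr (_ * _); apply: eq_bigr => i _; rewrite vw rmorphXn.
Qed.

Lemma frob_form_over (p : {mpoly K[3]}) : p \is a mpolyOver 3 (Fq K q) ->
  map_mpoly (fun x : K => x ^+ q) p = p.
Proof.
move=> /allP pL; apply/mpolyP => mm; rewrite (mcoeff_map_mpoly frobR).
change (frobR p@_mm = p@_mm).
have [pm|/memN_msupp_eq0 ->] := boolP (mm \in msupp p).
  by apply/eqP; apply: pL; apply/mapP; exists mm.
by rewrite rmorph0.
Qed.

Let frobF (F : 'I_3 -> {mpoly K[3]}) :=
  fun i => map_mpoly (fun x : K => x ^+ q) (F i).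

(** The value of a form with Frobenius-twisted coefficients at the Frobenius
    image of P is the q-th power of its value at P. *)
Lemma frob_transport E E' F (phi phi' : point E -> point E') (P : point E) :
  coefs_in (Fq K q) E -> coefs_in (Fq K q) E' ->
  represents F phi -> represents (frobF F) phi' -> defined_at F P ->
  phi' (frobpt P) = frobpt (phi P).
Proof.
move=> oE oE' rF rF' dF; have [c c0 hF] := rF P dF.
have FP i : (frobF F i).@[hcoord (frobpt P)] = (F i).@[hcoord P] ^+ q.
  by apply: frob_form_eval => j; rewrite hcoord_frobpt.
have dF' : defined_at (frobF F) (frobpt P).
  by have [i Fi] := dF; exists i; rewrite FP expf_neq0.
have [c' c'0 hF'] := rF' _ dF'.
apply: (@hcoord_prop _ _ _ (c' / c ^+ q)).
  by rewrite mulf_neq0 // invr_eq0 expf_neq0.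
move=> i; rewrite hF' FP hcoord_frobpt // hF exprMn mulrA divfK //.
by rewrite expf_neq0.
Qed.

Lemma frobpt_scalept E E' u r (P : point E) :
  coefs_in (Fq K q) E -> coefs_in (Fq K q) E' -> curve_iso E E' u r ->
  frobpt (scalept E' u r P) = scalept E' (u ^+ q) (r ^+ q) (frobpt P).
Proof.
move=> oE oE' c; elim/point_ind: P => [|x z xz] //.
rewrite scalept_mkpt // frobpt_mkpt; last exact: curve_iso_on xz.
rewrite frobpt_mkpt // scalept_mkpt; last exact: frob_on xz.
by congr mkpt; rewrite -!frobRE !(rmorphD, rmorphM, rmorphXn).
Qed.

Lemma curve_iso_frob E E' u r : coefs_in (Fq K q) E -> coefs_in (Fq K q) E' ->
  curve_iso E E' u r -> curve_iso E E' (u ^+ q) (r ^+ q).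
Proof.
move=> oE oE' [u0 c]; split; first by rewrite expf_neq0.
move=> y; have [x <-] := frob_surj y; rewrite -frob_cubic //.
have := congr1 frobR (c x); rewrite rmorphM rmorphXn !frobRE => ->.
by rewrite frob_cubic // -!frobRE !(rmorphD, rmorphM, rmorphXn).
Qed.

(** By [frob_transport] a conjugate of phi under Frobenius must be
    Frob \o phi \o Frob^-1. *)
Lemma is_Fr_scalept E E' u r (phi' : point E -> point E') :
  coefs_in (Fq K q) E -> coefs_in (Fq K q) E' -> curve_iso E E' u r ->
  is_Fr q (@scalept E E' u r) phi' <->
  phi' = @scalept E E' (u ^+ q) (r ^+ q).
Proof.
move=> oE oE' c; split=> [Fr|-> d F _ rF Q].
  apply: funext => Q; have [P <-] := frobpt_surj Q oE.
  rewrite -frobpt_scalept //.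
  have [[mphi _ _] _] : is_iso predT (@scalept E E' u r) /\ True.
    by split=> //; apply/is_isoT; exists u, r.
  have [d [F [fF dF rF]]] := mphi P.
  exact: frob_transport rF (Fr _ _ fF rF) dF.
have [P <-] := frobpt_surj Q oE.
have FP i : (frobF F i).@[hcoord (frobpt P)] = (F i).@[hcoord P] ^+ q.
  by apply: frob_form_eval => j; rewrite hcoord_frobpt.
move=> [i]; rewrite -/(frobF F i) FP => Fi.
have [|k k0 hF] := rF P.
  exists i; apply: contraNneq Fi => ->; have := rmorph0 frobR.
  by rewrite frobRE => ->.
exists (k ^+ q); first by rewrite expf_neq0.
move=> j; rewrite -/(frobF F j) FP -frobpt_scalept // hcoord_frobpt //.
by rewrite hF exprMn.
Qed.

(** Forms with coefficients in F_q are their own twists, so a morphism defined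
    over F_q commutes with Frobenius on points. *)
Lemma is_iso_Fq E E' u r : coefs_in (Fq K q) E -> coefs_in (Fq K q) E' ->
  curve_iso E E' u r ->
  is_iso (Fq K q) (@scalept E E' u r) <-> u ^+ q = u /\ r ^+ q = r.
Proof.
move=> oE oE' c; split=> [[mphi _ _]|[/eqP Lu /eqP Lr]]; last first.
  by apply: scalept_is_iso => //; apply: Fq_closed.
apply: (scalept_param_inj (curve_iso_frob oE oE' c) c) => Q.
have [P <-] := frobpt_surj Q oE; rewrite -frobpt_scalept //.
have [d [F [fF dF rF]]] := mphi P.
apply/esym/(frob_transport oE oE' rF _ dF).
rewrite (_ : frobF F = F) //; apply: funext => i.
by apply: frob_form_over; have [] := fF i.
Qed.

End Frob.

(** * Supersingularity *)

Lemma disc_b2 E : b2 E = 0 -> disc E = b4 E ^+ 3.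
Proof.
move=> b20; rewrite /disc b20.
apply: (@eq_char3 _ _ (- 3%:R * b4 E ^+ 3 - 9%:R * b6 E ^+ 2)); ring.
Qed.

Lemma jinv_eq0 E : disc E != 0 -> (jinv E = 0 <-> b2 E = 0).
Proof.
move=> d0; have c4E : c4 E = b2 E ^+ 2.
  by apply: (@eq_char3 _ _ (- 8%:R * b4 E)); rewrite /c4; ring.
rewrite /jinv c4E; split=> [/eqP|->]; last by rewrite !expr0n mul0r.
by rewrite mulf_eq0 invr_eq0 (negPf d0) orbF !expf_eq0 => /eqP.
Qed.

(** 3P = O means 2P = -P.  If 2P has the same x-coordinate as P, then the
    chord formula gives it the y-coordinate of -P.  In characteristic 3,
    x(2P) - x(P) = l^2 + a1 l - a2, with l the slope of the tangent at P. *)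
Lemma padd_triple E x y : let z := y + y + a1 E * x + a3 E in
  let l := (3%:R * x ^+ 2 + 2%:R * a2 E * x + a4 E - a1 E * y)
             / (2%:R * y + a1 E * x + a3 E) in
  iter 3 (padd E (Affine x y)) Infty = Infty <->
  z != 0 /\ l ^+ 2 + a1 E * l - a2 E = 0.
Proof.
move=> z l /=; rewrite eqxx -/z -/l.
have [z0|z0] := eqVneq z 0; first by split=> // -[].
rewrite /=; set x3 := l ^+ 2 + _ - _ - _ - _.
have x3E : l ^+ 2 + a1 E * l - a2 E = x3 - x.
  by apply: (@eq_char3 _ _ x); rewrite /x3; ring.
rewrite x3E; have [->|x30] := eqVneq x x3; last first.
  by split=> // -[_ /eqP]; rewrite subr_eq0 eq_sym (negPf x30).
rewrite subrr mulr0 add0r; split=> // _.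
by rewrite ifT //; apply/eqP; ring.
Qed.

(** The slope is l = (a1 z - (b2 x + b4)) / z, and z^2 (l^2 + a1 l - a2) is
    then (b2 x + b4)^2 - b2 z^2. *)
Lemma three_torsion E x z : z ^+ 2 = (cubic E).[x] ->
  iter 3 (padd E (mkpt E x z)) Infty = Infty <->
  z != 0 /\ (b2 E * x + b4 E) ^+ 2 = b2 E * z ^+ 2.
Proof.
move=> xz; rewrite mkptE //; set y := _ - z.
have zE : y + y + a1 E * x + a3 E = z.
  by apply: (@eq_char3 _ _ (a1 E * x + a3 E - z)); rewrite /y; ring.
have zE' : 2%:R * y + a1 E * x + a3 E = z by rewrite -[RHS]zE; ring.
have NE : 3%:R * x ^+ 2 + 2%:R * a2 E * x + a4 E - a1 E * y =
    - (b2 E * x + b4 E) + a1 E * z.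
  apply: (@eq_char3 _ _ (x ^+ 2 + 2%:R * a2 E * x + a4 E)).
  by rewrite /y /b2 /b4; ring.
apply: iff_trans (padd_triple E x y) _; rewrite zE zE' NE.
set M := b2 E * x + b4 E.
have key : z != 0 ->
    ((- M + a1 E * z) / z) ^+ 2 + a1 E * ((- M + a1 E * z) / z) - a2 E =
    (M ^+ 2 - b2 E * z ^+ 2) / z ^+ 2.
  move=> z0; apply: (mulIf (expf_neq0 2 z0)); rewrite divfK ?expf_neq0 //.
  transitivity ((- M + a1 E * z) ^+ 2 + a1 E * (- M + a1 E * z) * z
     - a2 E * z ^+ 2); first by field.
  apply: (@eq_char3 _ _ (- a1 E * M * z + (a1 E ^+ 2 + a2 E) * z ^+ 2)).
  by rewrite /b2; ring.
split=> -[z0 e]; split=> //.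
  move: e; rewrite key // => /eqP;
    rewrite mulf_eq0 invr_eq0 expf_eq0 (negPf z0).
  by rewrite andbF orbF subr_eq0 => /eqP.
by rewrite key // e subrr mul0r.
Qed.

Lemma b8_char3 E : b8 E = b2 E * b6 E - b4 E ^+ 2.
Proof.
by apply: (@eq_char3 _ _ (- b8 E)); rewrite /b8 /b2 /b4 /b6; ring.
Qed.

Lemma disc_char3 E :
  disc E = b2 E ^+ 2 * (b4 E ^+ 2 - b2 E * b6 E) + b4 E ^+ 3.
Proof.
rewrite /disc b8_char3; apply: (@eq_char3 _ _ (- 3%:R * b4 E ^+ 3
  - 9%:R * b6 E ^+ 2 + 3%:R * b2 E * b4 E * b6 E)); ring.
Qed.

(** If b2 = 0 then a point of order 3 forces b4 = 0 and a zero discriminant.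
    If b2 != 0, then replacing z^2 by f(x) turns the equation
    of [three_torsion] into b2 x^3 = b4^2 - b2 b6; its root x has z != 0,
    because otherwise b4 = - b2 x and the discriminant vanishes. *)
Lemma supersingularP E : disc E != 0 -> (jinv E = 0 <-> supersingular 3 E).
Proof.
move=> d0; apply: iff_trans (jinv_eq0 d0) _; split=> [B2 P|ss].
  elim/point_ind: P => // x z xz /(three_torsion xz) [_ /eqP].
  rewrite B2 !mul0r add0r expf_eq0 /= => /eqP B4.
  by move: d0; rewrite disc_b2 // B4 expr0n eqxx.
apply/eqP/negPn/negP => B2.
have /closed_rootP [x] : size ('X^3 - ((b4 E ^+ 2 - b2 E * b6 E) / b2 E)%:P)%R
  != 1%N by rewrite size_XnsubC.
rewrite /root !hornerE subr_eq0 => /eqP x3E.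
have x3 : b2 E * x ^+ 3 = b4 E ^+ 2 - b2 E * b6 E.
  by rewrite x3E mulrC divfK.
have [z xz] := sqrt_exists (cubic E).[x].
have Mz : (b2 E * x + b4 E) ^+ 2 = b2 E * z ^+ 2.
  rewrite xz cubicE; apply/eqP; rewrite -subr_eq0; apply/eqP.
  transitivity (b4 E ^+ 2 - b2 E * b6 E - b2 E * x ^+ 3);
    last by rewrite x3 subrr.
  by apply: (@eq_char3 _ _ (b2 E * b4 E * x)); ring.
have [z0|z0] := eqVneq z 0; last first.
  by apply: (mkpt_neqO xz); apply: ss; apply/three_torsion.
move/eqP: Mz; rewrite z0 expr0n mulr0 expf_eq0 /= addrC addr_eq0 => /eqP B4.
by move: d0; rewrite disc_char3 -x3 B4; apply/negP/negPn/eqP; ring.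
Qed.

(** * The curve y^2 = x^3 - x *)

Local Notation E := (E0 K).

Lemma cubic_short a b x : (cubic (short a b)).[x] = x ^+ 3 + a * x + b.
Proof.
rewrite cubicE /b2 /b4 /b6 /=; apply: (@eq_char3 _ _ (b - a * x)); ring.
Qed.

Lemma cubic_E0 x : (cubic E).[x] = x ^+ 3 - x.
Proof. by rewrite cubic_short mulN1r addr0. Qed.

Lemma quadratic_eq0 a b c : (forall x : K, a * x ^+ 2 + b * x + c = 0) ->
  [/\ a = 0, b = 0 & c = 0].
Proof.
move=> p0; have := p0 0; rewrite expr0n !mulr0 !add0r => c0.
have := p0 1; have := p0 (-1); rewrite c0 !addr0 sqrrN expr1n !mulr1 mulrN1.
move=> ab /eqP; rewrite addr_eq0 => /eqP aNb.
have /eqP : 2%:R * a = 0 by rewrite mulr_natl mulr2n {2}aNb ab.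
rewrite mulf_eq0 (negPf two_neq0) => /eqP a0; split=> //.
by move: aNb; rewrite a0 => /eqP; rewrite eq_sym oppr_eq0 => /eqP.
Qed.

(** The conditions are the coefficients of the polynomial identity
    u^6 (x^3 - x) = f(u^2 x + r). *)
Lemma curve_isoP E' u r : curve_iso E E' u r <->
  [/\ u != 0, b2 E' = 0, b4 E' = u ^+ 4 & b6 E' = u ^+ 4 * r - r ^+ 3].
Proof.
split=> [[u0 c]|[u0 B2 B4 B6]]; last first.
  split=> // x; rewrite cubic_E0 cubicE B2 B4 B6.
  apply: (@eq_char3 _ _ (- (u ^+ 4 * x ^+ 2 * r + u ^+ 2 * x * r ^+ 2))); ring.
have u2 : u ^+ 2 != 0 by rewrite expf_neq0.
have [] := @quadratic_eq0 (b2 E' * u ^+ 4)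
   (2%:R * b2 E' * u ^+ 2 * r - b4 E' * u ^+ 2 + u ^+ 6)
   (r ^+ 3 + b2 E' * r ^+ 2 - b4 E' * r + b6 E').
  move=> x; have := c x; rewrite cubic_E0 cubicE => cx.
  move/eqP: cx; rewrite eq_sym -subr_eq0 => /eqP <-.
  apply: (@eq_char3 _ _ (- (u ^+ 4 * x ^+ 2 * r + u ^+ 2 * x * r ^+ 2))); ring.
move=> /eqP; rewrite mulf_eq0 (negPf (expf_neq0 _ u0)) orbF => /eqP -> B4.
have {}B4 : b4 E' = u ^+ 4.
  apply: (mulIf u2); apply/eqP; rewrite -subr_eq0 -oppr_eq0 -B4; apply/eqP;
    ring.
move=> B6; split=> //; apply/eqP; rewrite -subr_eq0 -B6 B4; apply/eqP; ring.
Qed.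

Lemma curve_iso_elliptic E' u r : curve_iso E E' u r -> disc E' != 0.
Proof.
by move=> /curve_isoP [u0 B2 B4 _]; rewrite disc_b2 // B4 !expf_neq0.
Qed.

Lemma curve_iso_short a b u r : curve_iso E (short a b) u r <->
  [/\ u != 0, a = - u ^+ 4 & b = u ^+ 4 * r - r ^+ 3].
Proof.
have B2 : b2 (short a b) = 0 by rewrite /b2 /=; ring.
have B4 : b4 (short a b) = - a.
  by rewrite /b4 /=; apply: (@eq_char3 _ _ a); ring.
have B6 : b6 (short a b) = b.
  by rewrite /b6 /=; apply: (@eq_char3 _ _ b); ring.
split=> [/curve_isoP|] [u0]; rewrite ?B2 ?B4 ?B6.
  by move=> _ <- <-; rewrite opprK.
by move=> aE bE; apply/curve_isoP; rewrite B2 B4 B6 aE opprK.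
Qed.

Lemma curve_iso_exists E' : b2 E' = 0 -> disc E' != 0 ->
  exists u r, curve_iso E E' u r.
Proof.
move=> B2; rewrite disc_b2 // expf_eq0 /= => B4.
have /closed_rootP [u] : size ('X^4 - (b4 E')%:P)%R != 1%N by rewrite
  size_XnsubC.
rewrite /root !hornerE subr_eq0 => /eqP u4.
have /closed_rootP [r] : size (Poly [:: b6 E'; - b4 E'; 0; 1]) != 1%N.
  by rewrite (PolyK (c := 1)) //= oner_eq0.
rewrite /root horner_Poly /= => /eqP r3.
exists u, r; apply/curve_isoP; split=> //.
  by apply: contraNneq B4 => u0; rewrite -u4 u0 expr0n.
apply/eqP; rewrite -subr_eq0 -[X in _ == X]r3 u4; apply/eqP; ring.
Qed.

Lemma curve_iso_aut u r : curve_iso E E u r <-> u ^+ 4 = 1 /\ r ^+ 3 = r.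
Proof.
split=> [/curve_iso_short [u0 /oppr_inj <-]|[u4 r3]].
  rewrite mul1r => /esym /eqP; rewrite subr_eq0 => /eqP e.
  by split=> //.
apply/curve_iso_short; rewrite u4 r3 mul1r subrr; split=> //.
by apply/eqP => u0; move: u4; rewrite u0 expr0n => /esym/eqP; rewrite oner_eq0.
Qed.

Lemma in_F3 r : (r \in Fq K 3) <-> r ^+ 3 = r.
Proof. by split=> /eqP. Qed.

Lemma Phi_scalept u r : @Phi K u r = scalept E u r.
Proof.
apply: funext => P; rewrite /Phi /scalept.
case: (pt P) => [|x y] /=; first by rewrite /insubd insubT.
by rewrite /mkpt; congr (insubd _ (Affine _ _)); rewrite /zcoord /=; ring.
Qed.

Lemma Phi_inj u r u' r' : u ^+ 4 = 1 -> r ^+ 3 = r -> u' ^+ 4 = 1 ->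
  r' ^+ 3 = r' -> Phi u r = Phi u' r' -> u = u' /\ r = r'.
Proof.
move=> u4 r3 u'4 r'3; rewrite !Phi_scalept => e.
apply: (@scalept_param_inj E E); [exact/curve_iso_aut..|].
by move=> P; rewrite e.
Qed.

Lemma is_iso_E0 E' (psi : point E -> point E') : is_iso predT psi <->
  exists u r, curve_iso E E' u r /\ psi = scalept E' u r.
Proof. exact: is_isoT. Qed.

Lemma ECAutP phi : ECAut E phi <->
  exists u r, [/\ u ^+ 4 = 1, r ^+ 3 = r & phi = Phi u r].
Proof.
split=> [/is_isoT [u [r [/curve_iso_aut [u4 r3] ->]]]|[u [r [u4 r3 ->]]]].
  by exists u, r; rewrite Phi_scalept.
by apply/is_isoT; exists u, r; rewrite Phi_scalept; split=> //;
  apply/curve_iso_aut.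
Qed.

(** * Roots of unity of order 4, and F_3 *)

Lemma neg1_neq1 : (-1 != 1 :> K).
Proof. by rewrite -subr_eq0 -opprD oppr_eq0 -(natrD _ 1 1) two_neq0. Qed.

Lemma sqr1P t : t ^+ 2 = 1 <-> t = 1 \/ t = -1.
Proof.
split=> [/eqP|[] ->]; rewrite ?sqrrN ?expr1n // sqrf_eq1.
by case/orP => /eqP; [left|right].
Qed.

Lemma cube_idP r : r ^+ 3 = r <-> [\/ r = 0, r = 1 | r = -1].
Proof.
split=> [r3|]; last first.
  by case=> ->; rewrite ?expr0n ?expr1n // exprS sqrrN expr1n mulr1.
have : r * (r ^+ 2 - 1) = 0 by rewrite mulrBr -exprS r3 mulr1 subrr.
move/eqP; rewrite mulf_eq0 subr_eq0 => /orP [/eqP|/eqP/sqr1P []] ->;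
  by [apply: Or31|apply: Or32|apply: Or33].
Qed.

Lemma expr4_eq1P u : u ^+ 4 = 1 <-> u ^+ 2 = 1 \/ u ^+ 2 = -1.
Proof. by rewrite -sqr1P -exprM. Qed.

Lemma sqr1_cube t : t ^+ 2 = 1 -> t ^+ 3 = t.
Proof. by move=> t2; rewrite exprS t2 mulr1. Qed.

Lemma cube_id_exp r m : r ^+ 3 = r -> r ^+ (3 ^ m) = r.
Proof. by move=> r3; elim: m => [|m IH]; rewrite ?expr1 // expnS exprM r3. Qed.

Lemma expr4_neq0 u : u ^+ 4 = 1 -> u != 0.
Proof.
move=> u4; apply/eqP => u0; have := oner_neq0 K.
by rewrite -u4 u0 expr0n eqxx.
Qed.

Lemma frob_F9 u m : u ^+ 9 = u ->
  u ^+ (3 ^ m) = if odd m then u ^+ 3 else u.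
Proof.
move=> u9; elim: m => [|m IH] //; rewrite expnSr exprM IH /=.
by case: (odd m) => //=; rewrite -exprM.
Qed.

Lemma frob_mu4 u m : u ^+ 4 = 1 ->
  u ^+ (3 ^ m) = if odd m then u ^+ 3 else u.
Proof.
move=> u4; apply: frob_F9.
by rewrite (_ : 9%N = (4 * 2 + 1)%N) // exprD exprM u4 expr1n mul1r.
Qed.

(** * Cocycles *)

Section Twists.
Variable n : nat.
Local Notation q := (3 ^ n)%N.

Lemma coefs_in_E0 m : coefs_in (Fq K (3 ^ m)) E.
Proof.
have F0 : 0 \in Fq K (3 ^ m) by rewrite unfold_in /= expr0n gtn_eqF ?expn_gt0.
by split=> //=; apply/eqP; apply: cube_id_exp; apply/cube_idP; apply: Or33.
Qed.

Lemma is_inverse_uniq E1 E2 (f : point E1 -> point E2) g g' :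
  is_inverse f g -> is_inverse f g' -> g = g'.
Proof.
by move=> [fK _] [_ g'K]; apply: funext => P; rewrite -{1}(g'K P) fK.
Qed.

Lemma cocycle_valueP E' u r tau : coefs_in (Fq K q) E' -> curve_iso E E' u r ->
  cocycle_value q (scalept E' u r) tau <->
  tau = Phi (u / u ^+ q) ((r - r ^+ q) / (u ^+ q) ^+ 2).
Proof.
move=> oE' c; have oE := coefs_in_E0 n.
have cq := curve_iso_frob oE oE' c.
have uq0 : u ^+ q != 0 := cq.1.
have tauE : scalept E (u ^+ q)^-1 (- r ^+ q / (u ^+ q) ^+ 2) \o scalept E' u r =
    Phi (u / u ^+ q) ((r - r ^+ q) / (u ^+ q) ^+ 2).
  apply: funext => P; rewrite /= scalept_comp // Phi_scalept.
  apply: (congr2 (fun a b => scalept E a b P)); first by rewrite mulrC.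
  by move: (u ^+ q) (r ^+ q) uq0 => a b a0; field.
split=> [[psi' [t [/is_Fr_scalept -> // it ->]]]|->].
  by rewrite (is_inverse_uniq it (scalept_inv cq)).
exists (@scalept E E' (u ^+ q) (r ^+ q)).
exists (@scalept E' E (u ^+ q)^-1 (- r ^+ q / (u ^+ q) ^+ 2)).
by split; [apply/is_Fr_scalept|apply: scalept_inv|rewrite tauE].
Qed.

Lemma cocycle_param E' u r : coefs_in (Fq K q) E' -> curve_iso E E' u r ->
  (u / u ^+ q) ^+ 4 = 1 /\
  ((r - r ^+ q) / (u ^+ q) ^+ 2) ^+ 3 = (r - r ^+ q) / (u ^+ q) ^+ 2.
Proof.
move=> oE' c; have cq := curve_iso_frob (coefs_in_E0 n) oE' c.
apply/curve_iso_aut; have := curve_iso_comp c (curve_iso_inv cq).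
have uq0 : u ^+ q != 0 := cq.1.
have -> : (u ^+ q)^-1 * u = u / u ^+ q by rewrite mulrC.
suff -> : (u ^+ q)^-1 ^+ 2 * r + - r ^+ q / (u ^+ q) ^+ 2 =
  (r - r ^+ q) / (u ^+ q) ^+ 2 by [].
by field.
Qed.

(** For u^4 = 1, [eps (u^2)] is u^(q-1). *)
Definition eps (t : K) := if odd n then t else 1.

Lemma eps_mul t t' : eps (t * t') = eps t * eps t'.
Proof. by rewrite /eps; case: odd; rewrite ?mul1r. Qed.

Lemma eps1 : eps 1 = 1.
Proof. by rewrite /eps; case: odd. Qed.

Lemma eps_odd t : odd n -> eps t = t.
Proof. by rewrite /eps => ->. Qed.

Lemma eps_even t : ~~ odd n -> eps t = 1.
Proof. by rewrite /eps => /negPf ->. Qed.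

Lemma sqr_eps t : t ^+ 2 = 1 -> eps t ^+ 2 = 1.
Proof. by rewrite /eps; case: odd; rewrite ?expr1n. Qed.

Lemma eps_frob u : u ^+ 4 = 1 -> u ^+ q = u * eps (u ^+ 2).
Proof.
by move=> u4; rewrite frob_mu4 // /eps; case: odd; rewrite ?mulr1 -?exprS.
Qed.

(** Here u^2 = 1 / u^2 and u^(q-1) is its own inverse. *)
Lemma Phi_conj u r v s f : u ^+ 4 = 1 -> r ^+ 3 = r -> v ^+ 4 = 1 ->
  s ^+ 3 = s -> is_inverse (@Phi K u r) f ->
  f \o Phi v s \o Phi (u ^+ q) (r ^+ q) =
    Phi (v * eps (u ^+ 2)) (u ^+ 2 * ((v ^+ 2 - 1) * r + s)).
Proof.
move=> u4 r3 v4 s3; rewrite Phi_scalept => fK.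
have u0 := expr4_neq0 u4.
have c : curve_iso E E u r by apply/curve_iso_aut.
rewrite -(is_inverse_uniq (scalept_inv c) fK) (cube_id_exp n r3).
have cq : curve_iso E E (u ^+ q) r.
  by apply/curve_iso_aut; rewrite exprAC u4 expr1n.
have cv : curve_iso E E v s by apply/curve_iso_aut.
have cvq := curve_iso_comp cq cv.
apply: funext => P; rewrite !Phi_scalept /=.
rewrite (scalept_comp _ _ _ _ cq) (scalept_comp _ _ _ _ cvq) eps_frob //.
have e2 : eps (u ^+ 2) ^+ 2 = 1 by rewrite sqr_eps // -exprM.
have u2V : u^-1 ^+ 2 = u ^+ 2.
  by apply: (mulIf (expf_neq0 2 u0)); rewrite -exprMn mulVf // expr1n -exprD.
apply: (congr2 (fun a b => scalept E a b P));
  first by rewrite [v * _]mulrCA mulKf.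
rewrite mulrDr u2V -[u ^- 2]exprVn u2V; ring.
Qed.

(** Only t = u^2 matters in [Phi_conj], and every t = +-1 is such a square. *)
Lemma CsetE v s : v ^+ 4 = 1 -> s ^+ 3 = s ->
  @Cset K q v s = [set tau | exists t r, [/\ t ^+ 2 = 1, r ^+ 3 = r &
     tau = Phi (v * eps t) (t * ((v ^+ 2 - 1) * r + s))]].
Proof.
move=> v4 s3; apply/seteqP; split=> tau.
  move=> [u [r [f [u4 /in_F3 r3 fK ->]]]]; exists (u ^+ 2), r.
  by rewrite (Phi_conj u4 r3 v4 s3 fK) -exprM.
move=> [t [r [t2 r3 ->]]]; have [u ut] := sqrt_exists t.
have u4 : u ^+ 4 = 1 by rewrite (exprM u 2 2) ut.
have c : curve_iso E E u r by apply/curve_iso_aut.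
have fK := scalept_inv c; rewrite -Phi_scalept in fK.
exists u, r, (@scalept E E u^-1 (- r / u ^+ 2)).
by split=> //; [apply/in_F3|rewrite (Phi_conj u4 r3 v4 s3 fK) ut].
Qed.

Lemma Frob_class_Phi u r : u ^+ 4 = 1 -> r ^+ 3 = r ->
  Frob_class q (Phi u r) = @Cset K q u r.
Proof.
move=> u4 r3; apply/seteqP; split=> tau.
  move=> [f [f' [g [/ECAutP [v [s [v4 s3 ->]]] Ff fg ->]]]].
  exists v, s, g; split=> //; first exact/in_F3.
  congr (_ \o _ \o _); rewrite Phi_scalept in Ff.
  have c : curve_iso E E v s by apply/curve_iso_aut.
  by rewrite Phi_scalept; apply/(is_Fr_scalept _ (coefs_in_E0 n) (coefs_in_E0
    n) c).
move=> [v [s [g [v4 /in_F3 s3 fg ->]]]].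
exists (Phi v s), (Phi (v ^+ q) (s ^+ q)), g; split=> //.
  by apply/ECAutP; exists v, s.
have c : curve_iso E E v s by apply/curve_iso_aut.
rewrite !Phi_scalept.
by apply/(is_Fr_scalept _ (coefs_in_E0 n) (coefs_in_E0 n) c).
Qed.

Lemma mem_Cset v s v' s' : v ^+ 4 = 1 -> s ^+ 3 = s -> v' ^+ 4 = 1 ->
  s' ^+ 3 = s' -> @Cset K q v s (Phi v' s') <-> exists t r,
    [/\ t ^+ 2 = 1, r ^+ 3 = r, v' = v * eps t &
        s' = t * ((v ^+ 2 - 1) * r + s)].
Proof.
move=> v4 s3 v'4 s'3; rewrite CsetE //; split=> [[t [r [t2 r3]]]|].
  move=> /Phi_inj; case=> //; last by exists t, r.
    by rewrite exprMn v4 mul1r (exprM _ 2 2) sqr_eps // expr1n.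
  rewrite exprMn (sqr1_cube t2); congr (_ * _).
  have d3 : (v ^+ 2 - 1) ^+ 3 = v ^+ 2 - 1.
    by case/expr4_eq1P: v4 => ->; [rewrite subrr expr0n|
      apply: (@eq_char3 _ _ (- 2%:R)); ring].
  by have := rmorphD (frobR 1) ((v ^+ 2 - 1) * r) s;
    rewrite rmorphM !frobRE !expn1 d3 r3 s3.
by move=> [t [r [t2 r3 -> ->]]]; exists t, r.
Qed.

Lemma Cset_refl v s : v ^+ 4 = 1 -> s ^+ 3 = s -> @Cset K q v s (Phi v s).
Proof.
move=> v4 s3; apply/mem_Cset => //; exists 1, 0.
by rewrite expr1n expr0n eps1; split=> //; [rewrite mulr1|ring].
Qed.

(** The sets C_{v,s} are the classes of an equivalence relation. *)
Lemma Cset_eq v s v' s' : v ^+ 4 = 1 -> s ^+ 3 = s -> v' ^+ 4 = 1 ->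
  s' ^+ 3 = s' -> @Cset K q v s (Phi v' s') -> @Cset K q v s = @Cset K q v' s'.
Proof.
suff sub v1 s1 v2 s2 : v1 ^+ 4 = 1 -> s1 ^+ 3 = s1 -> v2 ^+ 4 = 1 ->
    s2 ^+ 3 = s2 -> @Cset K q v1 s1 (Phi v2 s2) ->
    @Cset K q v2 s2 `<=` @Cset K q v1 s1 /\ @Cset K q v2 s2 (Phi v1 s1).
  move=> v4 s3 v'4 s'3 vv'; have [sub1 v'v] := sub _ _ _ _ v4 s3 v'4 s'3 vv'.
  by apply/seteqP; split=> //; have [] := sub _ _ _ _ v'4 s'3 v4 s3 v'v.
move=> v4 s3 v'4 s'3 /mem_Cset [] // t [r [t2 r3 v2E s2E]].
have e2 : eps t ^+ 2 = 1 by apply: sqr_eps.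
have v22 : v2 ^+ 2 = v1 ^+ 2 by rewrite v2E exprMn e2 mulr1.
have tt : t * t = 1 by rewrite -expr2.
have F3D a b : a ^+ 3 = a -> b ^+ 3 = b -> (a + b) ^+ 3 = a + b.
  by move=> a3 b3; have := rmorphD (frobR 1) a b; rewrite !frobRE !expn1 a3 b3.
split.
  rewrite !CsetE // => tau [t' [r' [t'2 r'3 ->]]].
  exists (t * t'), (r + t * r'); split.
  - by rewrite exprMn t2 t'2 mulr1.
  - by apply: F3D; rewrite // exprMn r'3 sqr1_cube.
  rewrite eps_mul v22 v2E s2E mulrA; congr Phi.
  transitivity (t' * ((v1 ^+ 2 - 1) * (t * t) * r' + t * ((v1 ^+ 2 - 1) * r +
    s1))).
    by rewrite tt; ring.
  ring.
apply/mem_Cset => //; exists t, (- (t * r)); split=> //.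
- by rewrite -[in LHS]mulN1r exprMn (exprMn _ t) r3 (sqr1_cube t2) -signr_odd
  /= expr1 mulN1r.
- by rewrite v2E -mulrA -expr2 e2 mulr1.
rewrite v22 s2E.
transitivity ((t * t) * (- ((v1 ^+ 2 - 1) * r) + ((v1 ^+ 2 - 1) * r + s1))).
  by rewrite tt mul1r addKr.
ring.
Qed.

(** * The cocycles of a twist *)

Definition cocycles E' : set (point E -> point E) :=
  [set tau | exists psi : point E -> point E',
     is_iso predT psi /\ cocycle_value q psi tau].

(** Every isomorphism E -> E' is psi \o Phi_{w,p}, where psi has the parameters
    (u, r), and its cocycle is Frob(Phi_{w,p})^-1 \o tau \o Phi_{w,p} with tau
    the cocycle of psi.  The convention for Frobenius classes conjugates by
    Phi_{w,p}^-1 and Frob(Phi_{w,p}) instead; the resulting sets agree because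
    w^(q-1) = w^(1-q) and w^(2q) = w^2. *)
Lemma cocyclesE E' u r : coefs_in (Fq K q) E' -> curve_iso E E' u r ->
  cocycles E' = @Cset K q (u / u ^+ q) ((r - r ^+ q) / (u ^+ q) ^+ 2).
Proof.
move=> oE' c; have [v4 s3] := cocycle_param oE' c.
have uq0 : u ^+ q != 0 by rewrite expf_neq0 ?c.1.
have u0 : u != 0 := c.1.
have key w p : w ^+ 4 = 1 -> p ^+ 3 = p ->
   Phi ((u * w) / (u * w) ^+ q)
       ((u ^+ 2 * p + r - (u ^+ 2 * p + r) ^+ q) / ((u * w) ^+ q) ^+ 2) =
   Phi (u / u ^+ q * eps (w ^+ 2)) (w ^+ 2 *
      (((u / u ^+ q) ^+ 2 - 1) * p + (r - r ^+ q) / (u ^+ q) ^+ 2)).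
  move=> w4 p3; have w0 := expr4_neq0 w4.
  have w22 : (w ^+ 2) ^+ 2 = 1 by rewrite -exprM.
  have e2 : eps (w ^+ 2) ^+ 2 = 1 by apply: sqr_eps.
  have e0 : eps (w ^+ 2) != 0.
    by apply/eqP => e0; move/eqP: e2; rewrite e0 expr0n eq_sym oner_eq0.
  have eV : (eps (w ^+ 2))^-1 = eps (w ^+ 2).
    by apply: (mulIf e0); rewrite mulVf // -expr2.
  have -> : (u ^+ 2 * p + r) ^+ q = (u ^+ q) ^+ 2 * p + r ^+ q.
    have := rmorphD (frobR n) (u ^+ 2 * p) r; rewrite rmorphM rmorphXn !frobRE.
    by rewrite (cube_id_exp n p3).
  rewrite !(exprMn q u w) (eps_frob w4).
  move: (u ^+ q) (r ^+ q) uq0 => a b a0.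
  have -> : u * w / (a * (w * eps (w ^+ 2))) = u / a * eps (w ^+ 2).
    by rewrite -[in RHS]eV; field; rewrite ?a0 ?w0 ?e0.
  have w2V : w ^- 2 = w ^+ 2.
    by apply: (mulIf (expf_neq0 2 w0)); rewrite mulVf ?expf_neq0 // -exprD.
  congr Phi; rewrite !exprMn e2 mulr1 invfM w2V; field; exact: a0.
rewrite CsetE //; apply/seteqP; split=> tau.
  move=> [psi [/is_iso_E0 [u1 [r1 [c1 ->]]] /(cocycle_valueP _ oE' c1) ->]].
  have cw := curve_iso_comp c1 (curve_iso_inv c).
  have /curve_iso_aut [w4 p3] := cw.
  exists ((u^-1 * u1) ^+ 2), (u^-1 ^+ 2 * r1 + - r / u ^+ 2).
  rewrite -key // mulVKf //.
  rewrite (_ : u ^+ 2 * _ + r = r1); last by field.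
  by split=> //; rewrite -exprM.
move=> [t [p [t2 p3 ->]]]; have [w wt] := sqrt_exists t.
have w4 : w ^+ 4 = 1 by rewrite (exprM w 2 2) wt.
have cw : curve_iso E E w p by apply/curve_iso_aut.
exists (@scalept E E' (u * w) (u ^+ 2 * p + r)); split.
  by apply/is_iso_E0; exists (u * w), (u ^+ 2 * p + r); split=> //;
    exact: curve_iso_comp cw c.
apply/(cocycle_valueP _ oE' (curve_iso_comp cw c)).
by rewrite -wt -key.
Qed.

Lemma q_gt1 : (0 < n)%N -> (1 < q)%N.
Proof. by move=> n0; rewrite -[1%N](expn0 3) ltn_exp2l. Qed.

Lemma artin_schreier c : (0 < n)%N -> exists r : K, r ^+ q = r - c.
Proof.
move=> n0; have q2 := q_gt1 n0.
pose f : {poly K} := 'X^q + (c%:P - 'X).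
have : size f != 1%N.
  rewrite size_polyDl size_polyXn; first by lia.
  have : (size (c%:P - 'X)%R <= 2)%N.
    apply: leq_trans (size_polyD _ _) _.
    by rewrite geq_max size_polyN size_polyX size_polyC; case: (_ != 0).
  by move=> sz; apply: leq_ltn_trans sz _.
move/closed_rootP => [r].
rewrite /root !(hornerD, hornerN, hornerXn, hornerC, hornerX) => /eqP fr.
by exists r; apply/eqP; rewrite -subr_eq0 -[X in _ == X]fr opprB.
Qed.

(** The coefficients - u^4 and u^4 r - r^3 of the target curve are in F_q
    because u^q = u / v, r^q = r - s u^(2q), v^4 = 1 and s^3 = s. *)
Lemma twist_exists v s : v ^+ 4 = 1 -> s ^+ 3 = s -> (0 < n)%N ->
  exists E' u r, [/\ elliptic_over E' (Fq K q), curve_iso E E' u r,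
    v = u / u ^+ q & s = (r - r ^+ q) / (u ^+ q) ^+ 2].
Proof.
move=> v4 s3 n0; have v0 := expr4_neq0 v4.
have q2 := q_gt1 n0.
have [u u0 uq] : exists2 u : K, u != 0 & u ^+ q = u / v.
  have /closed_rootP [u] : size ('X^(q.-1) - (v^-1)%:P)%R != 1%N.
    by rewrite size_XnsubC; lia.
  rewrite /root !hornerE subr_eq0 => /eqP uE; exists u.
    apply/eqP => u0; move/eqP: uE; rewrite u0 expr0n gtn_eqF; last lia.
    by rewrite eq_sym invr_eq0 (negPf v0).
  by rewrite -uE -exprS prednK //; lia.
have [r rq] := artin_schreier (s * (u ^+ q) ^+ 2) n0.
have uq0 : u ^+ q != 0 by rewrite expf_neq0.
pose E' := short (- u ^+ 4) (u ^+ 4 * r - r ^+ 3).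
have c : curve_iso E E' u r by apply/curve_iso_short.
have u4q : (u ^+ 4) ^+ q = u ^+ 4.
  by rewrite exprAC uq expr_div_n v4 divr1.
exists E', u, r; split=> //; last 2 first.
- by rewrite uq; field; rewrite u0 v0.
- by rewrite rq opprB addrC subrK mulfK // expf_neq0.
split; last exact: curve_iso_elliptic c.
have F0 : 0 \in Fq K q by rewrite unfold_in /= expr0n gtn_eqF ?expn_gt0.
split=> //=; apply/eqP; rewrite -frobRE.
  by rewrite rmorphN /= /frob u4q.
rewrite rmorphB rmorphM [frobR n (r ^+ 3)]rmorphXn !frobRE u4q rq.
have -> : (r - s * (u ^+ q) ^+ 2) ^+ 3 = r ^+ 3 - s * (u ^+ q) ^+ 6.
  rewrite -[in RHS]s3; have := rmorphB (frobR 1) r (s * (u ^+ q) ^+ 2).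
  by rewrite !frobRE !expn1 => ->; ring.
have -> : (u ^+ q) ^+ 6 = u ^+ 4 * (u ^+ q) ^+ 2.
  by rewrite -[6%N]/(4 + 2)%N exprD exprAC u4q.
ring.
Qed.

(** * Isomorphism over F_q *)

Lemma iso_overP E1 E2 : coefs_in (Fq K q) E1 -> coefs_in (Fq K q) E2 ->
  iso_over (Fq K q) E1 E2 <->
  exists u r, [/\ curve_iso E1 E2 u r, u ^+ q = u & r ^+ q = r].
Proof.
move=> o1 o2; split=> [[phi iphi]|[u [r [c uq rq]]]].
  have [u [r [c phiE]]] := is_iso_scalept iphi.
  by exists u, r; move: iphi; rewrite phiE => /is_iso_Fq [].
by exists (@scalept E1 E2 u r); apply/is_iso_Fq.
Qed.

Lemma iso_over_sym E1 E2 : coefs_in (Fq K q) E1 -> coefs_in (Fq K q) E2 ->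
  iso_over (Fq K q) E1 E2 -> iso_over (Fq K q) E2 E1.
Proof.
move=> o1 o2 /iso_overP [] // u [r [c uq rq]]; apply/iso_overP => //.
exists u^-1, (- r / u ^+ 2); split; first exact: curve_iso_inv.
  by rewrite exprVn uq.
by rewrite -frobRE rmorphM rmorphN fmorphV rmorphXn !frobRE uq rq.
Qed.

Lemma iso_over_trans E1 E2 E3 : coefs_in (Fq K q) E1 ->
  coefs_in (Fq K q) E2 -> coefs_in (Fq K q) E3 ->
  iso_over (Fq K q) E1 E2 -> iso_over (Fq K q) E2 E3 ->
  iso_over (Fq K q) E1 E3.
Proof.
move=> o1 o2 o3 /iso_overP [] // u [r [c uq rq]].
move=> /iso_overP [] // u' [r' [c' u'q r'q]]; apply/iso_overP => //.
exists (u' * u), (u' ^+ 2 * r + r'); split; first exact: curve_iso_comp c c'.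
  by rewrite exprMn u'q uq.
by rewrite -frobRE rmorphD rmorphM rmorphXn !frobRE u'q rq r'q.
Qed.

Lemma iso_over_refl E1 : coefs_in (Fq K q) E1 -> iso_over (Fq K q) E1 E1.
Proof.
move=> o1; apply/iso_overP => //; exists 1, 0; split.
- exact: curve_iso_id.
- by rewrite expr1n.
- by rewrite expr0n gtn_eqF ?expn_gt0.
Qed.

Lemma iso_class_eq E1 E2 : elliptic_over E1 (Fq K q) ->
  elliptic_over E2 (Fq K q) ->
  iso_class (Fq K q) E1 = iso_class (Fq K q) E2 <-> iso_over (Fq K q) E1 E2.
Proof.
move=> e1 e2; have [o1 _] := e1; have [o2 _] := e2; split=> [e12|i12].
  suff [] : iso_class (Fq K q) E1 E2 by [].
  by rewrite e12; split=> //; apply: iso_over_refl.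
apply/seteqP; split=> E3 [e3 i3]; have [o3 _] := e3; split=> //.
  exact: iso_over_trans (iso_over_sym o1 o2 i12) i3.
exact: iso_over_trans i12 i3.
Qed.

Definition twist E' := elliptic_over E' (Fq K q) /\ iso_over predT E E'.

Lemma twistP E' : twist E' <->
  coefs_in (Fq K q) E' /\ exists u r, curve_iso E E' u r.
Proof.
split=> [[[o _] [psi /is_iso_E0 [u [r [c _]]]]]|[o [u [r c]]]].
  by split=> //; exists u, r.
split; first by split=> //; exact: curve_iso_elliptic c.
by exists (@scalept E E' u r); apply/is_iso_E0; exists u, r.
Qed.

(** If psi and psi' have the same cocycle, then psi' \o psi^-1 commutes with
    Frobenius. *)
Lemma cocycles_iso E1 E2 : twist E1 -> twist E2 ->
  cocycles E1 = cocycles E2 <-> iso_over (Fq K q) E1 E2.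
Proof.
move=> /twistP [o1 [u1 [r1 c1]]] /twistP [o2 [u2 [r2 c2]]].
have u1q0 : u1 ^+ q != 0 by rewrite expf_neq0 ?c1.1.
have u10 : u1 != 0 := c1.1.
split=> [|/iso_overP [] // w [p [cw wq pq]]]; last first.
  have c3 := curve_iso_comp c1 cw; have w0 : w != 0 := cw.1.
  rewrite (cocyclesE o1 c1) (cocyclesE o2 c3) exprMn wq.
  have -> : (w ^+ 2 * r1 + p) ^+ q = w ^+ 2 * r1 ^+ q + p.
    by rewrite -frobRE rmorphD rmorphM rmorphXn !frobRE wq pq.
  move: (u1 ^+ q) (r1 ^+ q) u1q0 => a b a0.
  by congr Cset; field; rewrite a0 w0.
rewrite (cocyclesE o2 c2) => co12.
have [v4 s3] := cocycle_param o2 c2.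
have : cocycles E1 (Phi (u2 / u2 ^+ q) ((r2 - r2 ^+ q) / (u2 ^+ q) ^+ 2)).
  by rewrite co12; apply: Cset_refl.
move=> [psi [/is_iso_E0 [u [r [c ->]]]]] /(cocycle_valueP _ o1 c).
have [v'4 s'3] := cocycle_param o1 c.
move=> /(Phi_inj v4 s3 v'4 s'3) [uE rE].
have uq0 : u ^+ q != 0 by rewrite expf_neq0 ?c.1.
have u2q0 : u2 ^+ q != 0 by rewrite expf_neq0 ?c2.1.
have u0 : u != 0 := c.1.
have wq : (u2 / u) ^+ q = u2 / u.
  rewrite expr_div_n; apply/eqP; rewrite eqr_div //.
  by move/eqP: uE; rewrite eqr_div // => /eqP ->; rewrite mulrC.
apply/iso_overP => //; exists (u2 * u^-1), (u2 ^+ 2 * (- r / u ^+ 2) + r2).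
split=> //; first exact: curve_iso_comp (curve_iso_inv c) c2.
have -> : u2 ^+ 2 * (- r / u ^+ 2) + r2 = r2 - (u2 / u) ^+ 2 * r by field.
rewrite -frobRE rmorphB rmorphM rmorphXn !frobRE wq.
apply/eqP; rewrite -subr_eq0; apply/eqP.
have rE' : r2 - r2 ^+ q = (r - r ^+ q) * (u2 / u) ^+ 2.
  by rewrite -wq expr_div_n expr_div_n -[LHS](divfK (expf_neq0 2 u2q0)) rE;
    field.
transitivity (- (r2 - r2 ^+ q) + (r - r ^+ q) * (u2 / u) ^+ 2); first by ring.
by rewrite rE'; ring.
Qed.

(** * Degrees of definition *)

Lemma frob_iter (x : K) m : x ^+ (q ^ m.+1) = (x ^+ (q ^ m)) ^+ q.
Proof. by rewrite -exprM expnSr. Qed.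

Lemma defined_in_degreeP E' u r d : coefs_in (Fq K q) E' ->
  curve_iso E E' u r ->
  u ^+ (q ^ d) = u -> r ^+ (q ^ d) = r ->
  (forall m, (0 < m)%N -> u ^+ (q ^ m) = u -> r ^+ (q ^ m) = r -> (d <= m)%N) ->
  defined_in_degree q d (@scalept E E' u r).
Proof.
have fixq m x : x ^+ q = x -> x ^+ (q ^ m) = x.
  by move=> xq; elim: m => [|m IH]; rewrite ?expr1 // expnS exprM xq.
move=> [/eqP f1 /eqP f2 /eqP f3 /eqP f4 /eqP f6] c ud rd dmin.
have oE m : coefs_in (Fq K (3 ^ (n * m))) E'.
  by rewrite expnM; split; apply/eqP; apply: fixq.
split=> [|m m0]; rewrite -expnM.
  by apply/(is_iso_Fq (coefs_in_E0 _) (oE d) c); rewrite expnM.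
by move=> /(is_iso_Fq (coefs_in_E0 _) (oE m) c); rewrite expnM => -[? ?];
  apply: dmin.
Qed.

Definition cocycle_degree v s d := forall E' u r, coefs_in (Fq K q) E' ->
  curve_iso E E' u r -> v = u / u ^+ q -> s = (r - r ^+ q) / (u ^+ q) ^+ 2 ->
  defined_in_degree q d (@scalept E E' u r).

(** Frobenius on (u, r) in terms of the cocycle; note that v^-1 = v^3. *)
Lemma cocycle_frob v s u r : v ^+ 4 = 1 -> u != 0 ->
  v = u / u ^+ q -> s = (r - r ^+ q) / (u ^+ q) ^+ 2 ->
  u ^+ q = u * v ^+ 3 /\ r ^+ q = r - s * v ^+ 2 * u ^+ 2.
Proof.
move=> v4 u0 vE sE; have v0 := expr4_neq0 v4.
have uq0 : u ^+ q != 0 by rewrite expf_neq0.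
have uE : u = v * u ^+ q by rewrite vE divfK.
have uqE : u ^+ q = u * v ^+ 3.
  by rewrite {2}uE mulrAC -exprS v4 mul1r.
split=> //; have v6 : (v ^+ 3) ^+ 2 = v ^+ 2.
  by rewrite -exprM (_ : (3 * 2)%N = (4 + 2)%N) // exprD v4 mul1r.
have -> : s * v ^+ 2 * u ^+ 2 = s * (u ^+ q) ^+ 2 by rewrite uqE exprMn v6;
  ring.
by rewrite sE divfK ?expf_neq0 // opprB addrC subrK.
Qed.

Lemma frob_iter_real v s u r m : v ^+ 2 = 1 -> s ^+ 3 = s ->
  u ^+ q = u * v ^+ 3 -> r ^+ q = r - s * v ^+ 2 * u ^+ 2 ->
  u ^+ (q ^ m) = u * v ^+ m /\ r ^+ (q ^ m) = r - s * u ^+ 2 * m%:R.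
Proof.
move=> v2 s3; rewrite v2 mulr1 (sqr1_cube v2) => uq rq.
have vq : v ^+ q = v by apply: cube_id_exp; apply: sqr1_cube.
elim: m => [|m [IHu IHr]]; first by rewrite !expr1 expr0 !mulr1 mulr0 subr0.
rewrite !frob_iter IHu IHr; split.
  by rewrite exprMn uq exprAC vq -mulrA -exprS.
rewrite -frobRE rmorphB 2!rmorphM rmorphXn rmorph_nat !frobRE rq uq.
rewrite (cube_id_exp n s3) exprMn v2 -[m.+1]addn1 natrD; ring.
Qed.

Lemma cocycle_degree_real v s d : v ^+ 2 = 1 -> s ^+ 3 = s ->
  v ^+ d = 1 -> s * d%:R = 0 ->
  (forall m, (0 < m)%N -> v ^+ m = 1 -> s * m%:R = 0 -> (d <= m)%N) ->
  cocycle_degree v s d.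
Proof.
move=> v2 s3 vd sd dmin E' u r o c vE sE; have u0 : u != 0 := c.1.
have [|uq rq] := cocycle_frob _ u0 vE sE; first by apply/expr4_eq1P; left.
have it m := frob_iter_real m v2 s3 uq rq.
apply: defined_in_degreeP => //.
- by rewrite (it d).1 vd mulr1.
- by rewrite (it d).2 mulrAC sd mul0r subr0.
move=> m m0; rewrite (it m).1 (it m).2 => um rm; apply: dmin => //.
  by apply: (mulfI u0); rewrite um mulr1.
apply/eqP; rewrite -(mulIr_eq0 _ (mulIf (expf_neq0 2 u0))) mulrAC.
by rewrite -oppr_eq0; apply/eqP/(addrI r); rewrite rm addr0.
Qed.

Lemma neq_opp1 v : v ^+ 2 = -1 -> v != 1.
Proof.
by move=> v2; apply: contraNneq neg1_neq1 => v1; rewrite -v2 v1 expr1n.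
Qed.

(** Frobenius fixes v and multiplies u by v^3 = - v, which has order 4.  The
    orbit of r has length 1 or 2. *)
Lemma cocycle_degree_imag v s : v ^+ 2 = -1 -> s ^+ 3 = s -> ~~ odd n ->
  cocycle_degree v s 4.
Proof.
move=> v2 s3 n_even E' u r o c vE sE; have u0 : u != 0 := c.1.
have v4 : v ^+ 4 = 1 by apply/expr4_eq1P; right.
have [uq rq] := cocycle_frob v4 u0 vE sE.
have vq : v ^+ q = v by rewrite frob_mu4 // (negPf n_even).
have v3 : v ^+ 3 = - v by rewrite exprS v2 mulrN1.
rewrite v3 in uq; rewrite v2 in rq.
have sq := cube_id_exp n s3.
have step x : (u * x) ^+ q = u * (- v) * x ^+ q by rewrite exprMn uq.
have u1 : u ^+ (q ^ 1) = u * - v by rewrite expn1.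
have Nq x : (- x) ^+ q = - x ^+ q by rewrite -!frobRE rmorphN.
have u2 : u ^+ (q ^ 2) = - u.
  rewrite frob_iter u1 step Nq vq -[RHS]mulrN1 -v2; ring.
have u3 : u ^+ (q ^ 3) = u * v.
  by rewrite frob_iter u2 Nq uq; ring.
have u4 : u ^+ (q ^ 4) = u.
  rewrite frob_iter u3 step vq -[RHS]mulr1 -[1]opprK -v2; ring.
have r1 : r ^+ q = r + s * u ^+ 2 by rewrite rq; ring.
have r2 : r ^+ (q ^ 2) = r.
  rewrite frob_iter expn1 r1 -frobRE rmorphD rmorphM rmorphXn !frobRE sq uq r1.
  by rewrite exprMn sqrrN v2; ring.
have r4 : r ^+ (q ^ 4) = r.
  by rewrite (expnM q 2 2) expnS expn1 exprM r2 r2.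
apply: defined_in_degreeP => // -[|[|[|[|m]]]] // _.
- rewrite u1 => /eqP; rewrite -subr_eq0 -[X in _ - X]mulr1 -mulrBr mulf_eq0.
  rewrite (negPf u0) /= subr_eq0 => /eqP v1;
    have : (- v) ^+ 2 = -1 by rewrite sqrrN.
  by move/neq_opp1; rewrite v1 eqxx.
- rewrite u2 => /eqP; rewrite -subr_eq0 -opprD oppr_eq0 -mulr2n -mulr_natr.
  by rewrite mulf_eq0 (negPf u0) (negPf two_neq0).
- rewrite u3 => /eqP; rewrite -subr_eq0 -[X in _ - X]mulr1 -mulrBr mulf_eq0.
  by rewrite (negPf u0) /= subr_eq0 (negPf (neq_opp1 v2)).
Qed.

(** Here Frobenius inverts v, and u^(q^2) = u v^3 v^9 = u. *)
Lemma cocycle_degree_imag_odd v : v ^+ 2 = -1 -> odd n ->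
  cocycle_degree v 0 2.
Proof.
move=> v2 n_odd E' u r o c vE sE; have u0 : u != 0 := c.1.
have v4 : v ^+ 4 = 1 by apply/expr4_eq1P; right.
have [uq rq] := cocycle_frob v4 u0 vE sE.
have vq : v ^+ q = v ^+ 3 by rewrite frob_mu4 // n_odd.
have v3 : v ^+ 3 = - v by rewrite exprS v2 mulrN1.
rewrite !mul0r subr0 in rq.
apply: defined_in_degreeP => // [|| [|[|m]]] //.
- rewrite frob_iter expn1 uq exprMn uq exprAC vq -mulrA -!exprM -exprD.
  by rewrite (_ : (3 + 3 * 3)%N = (4 * 3)%N) // exprM v4 expr1n mulr1.
- by rewrite frob_iter expn1 rq.
move=> _; rewrite expn1 uq v3 => /eqP; rewrite -subr_eq0 -[X in _ - X]mulr1.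
rewrite -mulrBr mulf_eq0 (negPf u0) /= subr_eq0 => /eqP v1.
have : (- v) ^+ 2 = -1 by rewrite sqrrN.
by move/neq_opp1; rewrite v1 eqxx.
Qed.

Lemma cocycle_twistP v s E' u r d : v ^+ 4 = 1 -> s ^+ 3 = s ->
  coefs_in (Fq K q) E' -> curve_iso E E' u r ->
  v = u / u ^+ q -> s = (r - r ^+ q) / (u ^+ q) ^+ 2 ->
  cocycle_degree v s d -> cocycle_twist q (Phi v s) E' d.
Proof.
move=> v4 s3 o c vE sE deg; split.
- by split=> //; exact: curve_iso_elliptic c.
- exists (@scalept E E' u r); split; first by apply/is_iso_E0; exists u, r.
  by apply/(cocycle_valueP _ o c); rewrite -vE -sE.
move=> psi /is_iso_E0 [u' [r' [c' ->]]] /(cocycle_valueP _ o c') tauE.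
have [v'4 s'3] := cocycle_param o c'.
by have [v'E s'E] := Phi_inj v4 s3 v'4 s'3 tauE; apply: deg.
Qed.

(** A class contains the cocycles of all isomorphisms from E to one of its
    twists, so the degree has to be the same for each of its elements. *)
Lemma class_degreeP v s d : (0 < n)%N -> v ^+ 4 = 1 -> s ^+ 3 = s ->
  (forall v' s', v' ^+ 4 = 1 -> s' ^+ 3 = s' -> @Cset K q v s (Phi v' s') ->
     cocycle_degree v' s' d) ->
  class_degree q (@Cset K q v s) d.
Proof.
move=> n0 v4 s3 deg; split.
  have [E' [u [r [e c vE sE]]]] := twist_exists v4 s3 n0; have [o _] := e.
  exists E', (@scalept E E' u r), (Phi v s); split=> //.
  - by apply/is_iso_E0; exists u, r.
  - by apply/(cocycle_valueP _ o c); rewrite -vE -sE.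
  - exact: Cset_refl.
move=> E' psi phi tau e /is_iso_E0 [u [r [c ->]]]; have [o _] := e.
move=> /(cocycle_valueP _ o c) ->.
have [v1 s1] := cocycle_param o c => /(Cset_eq v4 s3 v1 s1) Ceq.
move=> /is_iso_E0 [u' [r' [c' ->]]].
have [v1' s1'] := cocycle_param o c'.
apply: (deg _ _ v1' s1' _ _ _ _ o c') => //.
rewrite Ceq -(cocyclesE o c).
exists (@scalept E E' u' r'); split; first by apply/is_iso_E0; exists u', r'.
exact/(cocycle_valueP _ o c').
Qed.

(** * Traces *)

(** The sum telescopes. *)
Lemma trace3E r : trace3 n (r ^+ 3 - r) = r ^+ q - r.
Proof.
rewrite /trace3; elim: n => [|k IH]; first by rewrite big_ord0 expr1 subrr.
rewrite big_ord_recr /= IH -[(r ^+ 3 - r) ^+ _]frobRE rmorphB !frobRE -exprM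
  -expnS.
by rewrite addrC addrA subrK.
Qed.

(** * The classification *)

Section Main.
Hypothesis n_gt0 : (0 < n)%N.
Variable i : K.
Hypothesis i2 : i ^+ 2 = -1.
Local Notation C := (@Cset K q).

Lemma sqrN1P u : u ^+ 2 = -1 <-> u = i \/ u = - i.
Proof.
split=> [/eqP|[] ->]; rewrite ?sqrrN // -i2 eqf_sqr.
by case/orP => /eqP; [left|right].
Qed.

Lemma mu4P u : u ^+ 4 = 1 <-> [\/ u = 1, u = -1, u = i | u = - i].
Proof.
rewrite expr4_eq1P sqr1P sqrN1P; split.
  by case=> -[] ->; [apply: Or41|apply: Or42|apply: Or43|apply: Or44].
by case=> ->; [left; left|left; right|right; left|right; right].
Qed.

Let i4 : i ^+ 4 = 1. Proof. by apply/mu4P; apply: Or43. Qed.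
Let Ni4 : (- i) ^+ 4 = 1. Proof. by apply/mu4P; apply: Or44. Qed.
Let e4 : 1 ^+ 4 = 1 :> K. Proof. exact: expr1n. Qed.
Let Ne4 : (-1) ^+ 4 = 1 :> K. Proof. by apply/mu4P; apply: Or42. Qed.
Let z3 : 0 ^+ 3 = 0 :> K. Proof. by rewrite expr0n. Qed.
Let e3 : 1 ^+ 3 = 1 :> K. Proof. exact: expr1n. Qed.
Let Ne3 : (-1) ^+ 3 = -1 :> K. Proof. by apply/cube_idP; apply: Or33. Qed.
Let e2 : 1 ^+ 2 = 1 :> K. Proof. exact: expr1n. Qed.
Let Ne2 : (-1) ^+ 2 = 1 :> K. Proof. by rewrite sqrrN e2. Qed.
Let Ni2 : (- i) ^+ 2 = -1. Proof. by rewrite sqrrN. Qed.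

Let mu4E : ((1 == -1 :> K) = false) * ((1 == i) = false) * ((1 == - i) = false)
  * ((-1 == i) = false) * ((-1 == - i) = false) * ((i == - i) = false)
  * ((0 == 1 :> K) = false) * ((0 == -1 :> K) = false).
Proof.
have i1 : (1 == i) = false by rewrite eq_sym (negPf (neq_opp1 i2)).
have Ni1 : (1 == - i) = false by rewrite eq_sym (negPf (neq_opp1 Ni2)).
do !split=> //; rewrite ?eqr_opp //.
- by rewrite eq_sym (negPf neg1_neq1).
- by rewrite eqr_oppLR.
- rewrite -subr_eq0 opprK -mulr2n -mulr_natr mulf_eq0 (negPf two_neq0) orbF.
  by rewrite (negPf (expr4_neq0 i4)).
- by rewrite eq_sym oner_eq0.
- by rewrite eq_sym oppr_eq0 oner_eq0.
Qed.

(** ** Automorphisms *)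

Definition aut_params : seq (K * K) :=
  [seq (u, r) | u <- [:: 1; -1; i; - i], r <- [:: 0; 1; -1]].

Lemma aut_paramsP p : p \in aut_params <-> p.1 ^+ 4 = 1 /\ p.2 ^+ 3 = p.2.
Proof.
case: p => u r; rewrite /aut_params; split.
  move=> up; have [[u' r'] /= []] := allpairsP up;
    rewrite !inE => u'P r'P [-> ->].
  split; first by apply/mu4P; case/or4P: u'P => /eqP ->;
    [apply: Or41|apply: Or42|apply: Or43|apply: Or44].
  by apply/cube_idP; case/or3P: r'P => /eqP ->;
    [apply: Or31|apply: Or32|apply: Or33].
move=> [u4 r3]; apply: (allpairs_f pair); rewrite !inE.
  by have /mu4P [/= ->|/= ->|/= ->|/= ->] := u4; rewrite eqxx ?orbT.
by have /cube_idP [/= ->|/= ->|/= ->] := r3; rewrite eqxx ?orbT.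
Qed.

Lemma ECAut_params :
  ECAut E = [set Phi p.1 p.2 | p in [set p | p \in aut_params]].
Proof.
apply/seteqP; split=> phi.
  move/ECAutP => [u [r [u4 r3 ->]]].
  by exists (u, r) => //; apply/aut_paramsP.
by move=> [[u r] /aut_paramsP [u4 r3] <-]; apply/ECAutP; exists u, r.
Qed.

Lemma card_ECAut : ECAut E #= `I_12.
Proof.
rewrite ECAut_params; apply: (@card_image_seq _ _ _ aut_params (0, 0)).
  apply: allpairs_uniq; last by move=> [u r] [u' r'] _ _ [-> ->].
    by rewrite /= !inE !mu4E.
  by rewrite /= !inE !mu4E.
move=> [u r] [u' r'] /aut_paramsP [u4 r3] /aut_paramsP [u'4 r'3] /=.
by move=> /(Phi_inj u4 r3 u'4 r'3) /= [-> ->].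
Qed.

(** ** Frobenius classes *)

Lemma Frob_classesE : Frob_classes q E =
  [set A | exists v s, [/\ v ^+ 4 = 1, s ^+ 3 = s & A = C v s]].
Proof.
apply/seteqP; split=> A.
  move=> [tau /ECAutP [v [s [v4 s3 ->]]] <-].
  by exists v, s; rewrite Frob_class_Phi.
move=> [v [s [v4 s3 ->]]]; exists (Phi v s); last exact: Frob_class_Phi.
by apply/ECAutP; exists v, s.
Qed.

(** If v^2 = 1 then r drops out of [CsetE] and only t = +-1 remains. *)
Lemma Cset_real v s : v ^+ 2 = 1 -> s ^+ 3 = s ->
  C v s = [set Phi v s; Phi (v * eps (-1)) (- s)].
Proof.
move=> v2 s3; rewrite CsetE //; last by apply/expr4_eq1P; left.
rewrite v2 subrr.
apply/seteqP; split=> phi.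
  move=> [t [r [/sqr1P [] -> _ ->]]]; rewrite mul0r add0r.
    by left; rewrite eps1 mulr1 mul1r.
  by right; rewrite mulN1r.
case=> ->; [exists 1, 0|exists (-1), 0]; rewrite mul0r add0r.
  by rewrite eps1 mulr1 mul1r.
by rewrite mulN1r.
Qed.

Let imag_coef v : v ^+ 2 = -1 -> v ^+ 2 - 1 = 1.
Proof. by move=> ->; apply: (@eq_char3 _ _ (-1)); ring. Qed.

Let F3_add a b : a ^+ 3 = a -> b ^+ 3 = b -> (a + b) ^+ 3 = a + b.
Proof.
by move=> a3 b3; have := rmorphD (frobR 1) a b; rewrite !frobRE !expn1 a3 b3.
Qed.

Let F3_opp a : a ^+ 3 = a -> (- a) ^+ 3 = - a.
Proof. by move=> a3; rewrite -mulN1r exprMn a3 Ne3. Qed.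

(** If v^2 = -1 then v^2 - 1 = 1 and t (r + s) runs through F_3. *)
Lemma Cset_imag_even v s : ~~ odd n -> v ^+ 2 = -1 -> s ^+ 3 = s ->
  C v s = [set Phi v r | r in [set r | r \in Fq K 3]].
Proof.
move=> n_even v2 s3; rewrite CsetE //; last by apply/expr4_eq1P; right.
rewrite imag_coef //; apply/seteqP; split=> phi.
  move=> [t [r [t2 r3 ->]]]; rewrite eps_even // mulr1 mul1r.
  exists (t * (r + s)) => //; apply/in_F3.
  by rewrite exprMn (sqr1_cube t2) F3_add.
move=> [r /in_F3 r3 <-]; exists 1, (r - s); rewrite e2 eps1 mulr1 !mul1r subrK.
by split=> //; rewrite F3_add // F3_opp.
Qed.

Lemma Cset_imag_odd v s : odd n -> v ^+ 2 = -1 -> s ^+ 3 = s ->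
  C v s = [set phi | exists u r,
            [/\ u ^+ 2 = -1, r \in Fq K 3 & phi = Phi u r]].
Proof.
move=> n_odd v2 s3; rewrite CsetE //; last by apply/expr4_eq1P; right.
rewrite imag_coef //; apply/seteqP; split=> phi.
  move=> [t [r [t2 r3 ->]]]; exists (v * t), (t * (r + s));
    rewrite eps_odd // mul1r.
  split=> //; first by rewrite exprMn v2 t2 mulr1.
  by apply/in_F3; rewrite exprMn (sqr1_cube t2) F3_add.
move=> [u [r [u2' /in_F3 r3 ->]]].
have v0 : v != 0 by apply: expr4_neq0; apply/expr4_eq1P; right.
have t2 : (u / v) ^+ 2 = 1 by rewrite expr_div_n u2' v2 divff // oppr_eq0
  oner_eq0.
have tt : (u / v) * (u / v) = 1 by rewrite -expr2.
exists (u / v), ((u / v) * r - s);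
  rewrite mul1r subrK mulrA tt mul1r eps_odd // [v * _]mulrC divfK //.
split=> //; apply: F3_add; last exact: F3_opp.
by rewrite exprMn r3 (sqr1_cube t2).
Qed.

Lemma Cset_eq_params v s v' s' : v ^+ 4 = 1 -> s ^+ 3 = s -> v' ^+ 4 = 1 ->
  s' ^+ 3 = s' -> C v s = C v' s' ->
  [/\ v' ^+ 2 = v ^+ 2, ~~ odd n -> v' = v &
      v ^+ 2 = 1 -> exists2 t, t ^+ 2 = 1 & v' = v * eps t /\ s' = t * s].
Proof.
move=> v4 s3 v'4 s'3 CC; have : C v s (Phi v' s') by rewrite CC;
  exact: Cset_refl.
move=> /mem_Cset [] // t [r [t2 r3 v'E s'E]]; split.
- by rewrite v'E exprMn sqr_eps // mulr1.
- by move=> n_even; rewrite v'E eps_even // mulr1.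
by move=> v2; exists t => //; split=> //; rewrite s'E v2 subrr mul0r add0r.
Qed.

(** The parameters of one element in each Frobenius class. *)
Definition reps : seq (K * K) :=
  if odd n then [:: (1, 0); (1, 1); (1, -1); (i, 0)]
  else [:: (1, 0); (-1, 0); (1, 1); (-1, 1); (i, 0); (- i, 0)].

Lemma repsP p : p \in reps -> (p.1 ^+ 4 = 1 /\ p.2 ^+ 3 = p.2) /\
  (p.1 ^+ 2 = 1 /\ (odd n -> p.1 = 1) /\ (~~ odd n -> p.2 != -1) \/
   p.1 ^+ 2 = -1 /\ p.2 = 0 /\ (odd n -> p.1 = i)).
Proof.
have N0 : 0 != -1 :> K by rewrite mu4E.
have N1 : 1 != -1 :> K by rewrite mu4E.
rewrite /reps; case: odd; rewrite !inE.
  by case/or4P => /eqP -> /=; split=> //; [left|left|left|right].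
case/orP=> [/eqP ->|/orP[/eqP ->|/or4P[] /eqP ->]] /=; split=> //;
  by [left|left|left|left|right|right].
Qed.

(** The sets C_{v,s} with v^2 = 1 and those with v^2 = -1 are distinct.  In the
    first case s is determined up to the sign t, which for odd n is fixed by
    v' = v t = v, and for even n by s being 0 or 1. *)
Lemma Cset_inj : {in reps &, injective (fun p => C p.1 p.2)}.
Proof.
have cross v v' : v ^+ 2 = 1 -> v' ^+ 2 = -1 -> v' ^+ 2 = v ^+ 2 -> False.
  by move=> -> -> /eqP; rewrite (negPf neg1_neq1).
move=> [v s] [v' s'] /repsP /= [[v4 s3] vs] /repsP /= [[v'4 s'3] vs'] CC.
have [v2 v_even real] := Cset_eq_params v4 s3 v'4 s'3 CC.
case: vs vs' => [[v1 [v_odd s_even]]|[vi [-> v_odd]]]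
  [[v'1 [v'_odd s'_even]]|[v'i [-> v'_odd]]]; first last.
- congr (_, _); case: (boolP (odd n)) => n_odd; first by rewrite v_odd ?v'_odd.
  by rewrite v_even.
- by case: (cross v' v).
- by case: (cross v v').
have [t t2 [v'E s'E]] := real v1.
case: (boolP (odd n)) => n_odd.
  move: v'E s'E; rewrite v_odd // v'_odd // eps_odd // mul1r => <-.
  by rewrite mul1r => ->.
rewrite v_even //; congr (_, _); case/sqr1P: t2 s'E => ->; rewrite ?mul1r //.
rewrite mulN1r => s'E; move: (s_even n_odd) (s'_even n_odd); rewrite s'E.
by case/cube_idP: s3 => ->; rewrite ?oppr0 ?opprK ?eqxx.
Qed.

Lemma reps_uniq : uniq reps.
Proof.
by rewrite /reps; case: odd; rewrite /= !inE !xpair_eqE !eqxx /= !mu4E ?andbF.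
Qed.

(** For v^2 = -1 the coordinate s can be moved to 0.  For v^2 = 1, taking
    t = -1 changes the sign of s, and also that of v when n is odd. *)
Lemma Frob_classes_reps :
  Frob_classes q E = [set C p.1 p.2 | p in [set p | p \in reps]].
Proof.
rewrite Frob_classesE; apply/seteqP; split=> A; last first.
  by move=> [p /repsP [[v4 s3] _] <-]; exists p.1, p.2.
move=> [v [s [v4 s3 ->]]].
suff [p [t [r [pr t2 r3 vE sE]]]] : exists p t r, [/\ p \in reps, t ^+ 2 = 1,
    r ^+ 3 = r, v = p.1 * eps t & s = t * ((p.1 ^+ 2 - 1) * r + p.2)].
  exists p => //; have [[v'4 s'3] _] := repsP pr.
  by apply: Cset_eq => //; apply/mem_Cset => //; exists t, r.
case: (boolP (odd n)) => n_odd; case/expr4_eq1P: (v4) => v2.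
- have vs3 : (v * s) ^+ 3 = v * s by rewrite exprMn (sqr1_cube v2) s3.
  exists (1, v * s), v, 0; split=> //=.
  + rewrite /reps n_odd !inE !xpair_eqE eqxx /=.
    by case/cube_idP: vs3 => ->; rewrite eqxx ?orbT.
  + by rewrite eps_odd // mul1r.
  + by rewrite mulr0 add0r mulrA -expr2 v2 mul1r.
- have [t vE t2] : exists2 t, v = i * t & t ^+ 2 = 1.
    by case/sqrN1P: v2 => ->; [exists 1|exists (-1)]; rewrite ?mulr1 ?mulrN1.
  exists (i, 0), t, (t * s); split=> //=.
  + by rewrite /reps n_odd !inE eqxx ?orbT.
  + by rewrite exprMn (sqr1_cube t2) s3.
  + by rewrite eps_odd.
  + by rewrite imag_coef // mul1r addr0 mulrA -expr2 t2 mul1r.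
- have [s' [t [sE t2 s'01]]] : exists s' t,
      [/\ s = t * s', t ^+ 2 = 1 & s' = 0 \/ s' = 1].
    case/cube_idP: s3 => ->.
    + by exists 0, 1; rewrite mulr0; split=> //; left.
    + by exists 1, 1; rewrite mulr1; split=> //; right.
    + by exists 1, (-1); rewrite mulr1; split=> //; right.
  exists (v, s'), t, 0; split=> //=.
  + rewrite /reps (negPf n_odd) !inE !xpair_eqE.
    by case/sqr1P: v2 s'01 => -> [] ->; rewrite !eqxx ?andbT /= ?orbT.
  + by rewrite eps_even // mulr1.
  + by rewrite mulr0 add0r.
- exists (v, 0), 1, s; split=> //=.
  + rewrite /reps (negPf n_odd) !inE !xpair_eqE.
    by case/sqrN1P: v2 => ->; rewrite !eqxx ?andbT /= ?orbT.
  + by rewrite eps1 mulr1.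
  + by rewrite imag_coef // !mul1r addr0.
Qed.

Lemma card_Frob_classes : Frob_classes q E #= `I_(if odd n then 4 else 6).
Proof.
rewrite Frob_classes_reps.
have := card_image_seq (0, 0) reps_uniq Cset_inj.
by rewrite (_ : size reps = if odd n then 4 else 6) // /reps; case: odd.
Qed.

(** ** Classes of twists *)

Lemma twist_E0 : twist E.
Proof.
by apply/twistP; split; [exact: coefs_in_E0|exists 1, 0; exact: curve_iso_id].
Qed.

Lemma cocycles_E0 : cocycles E = C 1 0.
Proof.
rewrite (cocyclesE (coefs_in_E0 n) (curve_iso_id E)) !expr1n divr1.
by rewrite expr0n gtn_eqF ?expn_gt0 // subrr mul0r.
Qed.

Lemma Frob_classes_cocycles :
  Frob_classes q E = [set cocycles E' | E' in twist].
Proof.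
rewrite Frob_classesE; apply/seteqP; split=> A.
  move=> [v [s [v4 s3 ->]]].
  have [E' [u [r [e c vE sE]]]] := twist_exists v4 s3 n_gt0; have [o _] := e.
  exists E'; first by apply/twistP; split=> //; exists u, r.
  by rewrite (cocyclesE o c) -vE -sE.
move=> [E' /twistP [o [u [r c]]] <-]; rewrite (cocyclesE o c).
have [v4 s3] := cocycle_param o c.
by exists (u / u ^+ q), ((r - r ^+ q) / (u ^+ q) ^+ 2).
Qed.

Local Notation cls := (iso_class (Fq K q)).

Lemma cls_eq E1 E2 : twist E1 -> twist E2 ->
  cls E1 = cls E2 <-> cocycles E1 = cocycles E2.
Proof.
move=> t1 t2; apply: iff_trans (iso_class_eq t1.1 t2.1) _.
by apply: iff_sym; apply: cocycles_iso.
Qed.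

(** Both conditions say that b2 = 0. *)
Lemma twist_jinv : [set E' | elliptic_over E' (Fq K q) /\ jinv E' = 0] = twist.
Proof.
apply/seteqP; split=> E' /= [].
  move=> [o d0] /(jinv_eq0 d0) B2; apply/twistP; split=> //.
  exact: curve_iso_exists.
move=> e iE; split=> //; apply/(jinv_eq0 e.2).
have /twistP [_ [u [r /curve_isoP [] //]]] : twist E' by split.
Qed.

Lemma card_jinv0 :
  [set cls E' | E' in [set E' | elliptic_over E' (Fq K q) /\ jinv E' = 0]]
    #= `I_(if odd n then 4 else 6).
Proof.
apply: card_eq_trans card_Frob_classes;
  rewrite Frob_classes_cocycles twist_jinv.
by apply: (card_image_eq set0) => E1 E2 t1 t2; apply: cls_eq.
Qed.

Lemma nontrivial_twistsE : nontrivial_twist_classes q E =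
  [set cls E' | E' in [set E' | twist E' /\ cocycles E' <> C 1 0]].
Proof.
congr ((fun S => [set cls E' | E' in S]) _); apply/seteqP; split=> E' /=.
  move=> [e iE niE]; split=> //; rewrite -cocycles_E0 => co; apply: niE.
  by apply/cocycles_iso => //; exact: twist_E0.
move=> [[e iE] nco]; split=> //.
by move/(cocycles_iso twist_E0 (conj e iE)); rewrite cocycles_E0 => /esym.
Qed.

Lemma cocycle_twist_cocycles v s E' d : v ^+ 4 = 1 -> s ^+ 3 = s ->
  cocycle_twist q (Phi v s) E' d -> twist E' /\ cocycles E' = C v s.
Proof.
move=> v4 s3 [e [psi [ipsi psi_co]] _].
have t : twist E' by split=> //; exists psi.
split=> //; have [o [u [r c]]] := (twistP _).1 t.
have [v'4 s'3] := cocycle_param o c.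
rewrite (cocyclesE o c); apply: Cset_eq => //.
by rewrite -(cocyclesE o c); exists psi.
Qed.

Section Odd.
Hypothesis n_odd : odd n.

Let repsE : reps = [:: (1, 0); (1, 1); (1, -1); (i, 0)].
Proof. by rewrite /reps n_odd. Qed.

Lemma Frob_classes_odd :
  Frob_classes q E = [set C 1 0; C 1 1; C 1 (-1); C i 0].
Proof.
rewrite Frob_classes_reps repsE; apply/seteqP; split=> A.
  move=> [p]; rewrite /= !inE => /or4P[] /eqP -> <-;
    [by left; left; left|by left; left; right|by left; right|by right].
by case=> [[[]|]|] ->; [exists (1, 0)|exists (1, 1)|exists (1, -1)|exists (i,
  0)];
  rewrite //= !inE eqxx ?orbT.
Qed.

Lemma nontrivial_twists_odd E1 E2 E3 d1 d2 d3 :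
  cocycle_twist q (Phi i 0) E1 d1 -> cocycle_twist q (Phi 1 1) E2 d2 ->
  cocycle_twist q (Phi 1 (-1)) E3 d3 ->
  nontrivial_twist_classes q E = [set cls E1; cls E2; cls E3].
Proof.
move=> /(cocycle_twist_cocycles i4 z3) [t1 co1].
move=> /(cocycle_twist_cocycles e4 e3) [t2 co2].
move=> /(cocycle_twist_cocycles e4 Ne3) [t3 co3].
have C_neq p : p \in behead reps -> C p.1 p.2 <> C 1 0.
  move=> pr CC; have p10 : p = (1, 0).
    apply: (@Cset_inj p (1, 0)) => //; first exact: mem_behead pr.
    by rewrite repsE !inE eqxx.
  by move: pr; rewrite repsE p10 /= !inE !xpair_eqE !mu4E !andbF.
rewrite nontrivial_twistsE; apply/seteqP; split=> A.
  move=> [E' [tE' co'] <-].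
  have : Frob_classes q E (cocycles E').
    by rewrite Frob_classes_cocycles; exists E'.
  rewrite Frob_classes_odd => -[[[]|]|] // co.
  - by left; right; apply/cls_eq => //; rewrite co co2.
  - by right; apply/cls_eq => //; rewrite co co3.
  - by left; left; apply/cls_eq => //; rewrite co co1.
case=> [[]|] ->; [exists E1|exists E2|exists E3] => //; split=> //.
- by rewrite co1; apply: (C_neq (i, 0)); rewrite repsE !inE eqxx ?orbT.
- by rewrite co2; apply: (C_neq (1, 1)); rewrite repsE !inE eqxx ?orbT.
- by rewrite co3; apply: (C_neq (1, -1)); rewrite repsE !inE eqxx ?orbT.
Qed.

(** The non-trivial twists correspond to the classes other than C_{1,0}. *)
Lemma card_nontrivial_twists_odd : nontrivial_twist_classes q E #= `I_3.
Proof.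
rewrite nontrivial_twistsE.
have sub_reps : {subset behead reps <= reps} by move=> p; apply: mem_behead.
have u3 : uniq (behead reps) by move: reps_uniq; rewrite repsE => /andP[].
have := card_image_seq (0, 0) u3 (sub_in2 sub_reps Cset_inj).
rewrite [in `I_ _]repsE; apply: card_eq_trans.
have <- : [set cocycles E' | E' in
    [set E' | twist E' /\ cocycles E' <> C 1 0]] =
    [set C p.1 p.2 | p in [set p | p \in behead reps]].
  apply/seteqP; split=> A.
    move=> [E' [tE' co'] <-].
    have : Frob_classes q E (cocycles E').
      by rewrite Frob_classes_cocycles; exists E'.
    rewrite Frob_classes_reps => -[p pr pE]; exists p => //.
    move: pr; rewrite /= repsE inE => /orP[/eqP p1|//].
    by case: co'; rewrite -pE p1.
  move=> [p pr <-]; have : Frob_classes q E (C p.1 p.2).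
    by rewrite Frob_classes_reps; exists p => //; apply: sub_reps.
  rewrite Frob_classes_cocycles => -[E' tE' pE]; exists E' => //.
  split=> //; rewrite pE => CC; have p10 : p = (1, 0).
    apply: (@Cset_inj p (1, 0)) => //; first exact: sub_reps.
    by rewrite repsE !inE eqxx.
  by move: pr; rewrite /= repsE p10 /= !inE !xpair_eqE !mu4E !andbF.
apply: (card_image_eq set0) => E1 E2 [t1 _] [t2 _]; exact: cls_eq.
Qed.

(** If u^2 = 1/w then u^4 = -1 and (x, y) |-> (u^2 x, u^3 y) maps E to
    y^2 = x^3 + x.  Its cocycle has the parameter u / u^q = u^-2 = w, because
    u^8 = 1 and q = 3 modulo 8. *)
Lemma cocycle_twist_quartic w : w ^+ 2 = -1 ->
  cocycle_twist q (Phi w 0) (short 1 0) 2.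
Proof.
move=> w2; have w4 : w ^+ 4 = 1 by apply/expr4_eq1P; right.
have w0 := expr4_neq0 w4; have [u uw] := sqrt_exists w^-1.
have u0 : u != 0.
  by apply/eqP => u0; move/eqP: uw;
    rewrite u0 expr0n eq_sym invr_eq0 (negPf w0).
have u4 : u ^+ 4 = -1.
  by rewrite (exprM u 2 2) uw exprVn w2 invrN invr1.
have F0 : 0 ^+ q = 0 :> K by rewrite expr0n gtn_eqF ?expn_gt0.
have F1 : 1 ^+ q = 1 :> K by rewrite expr1n.
apply: (@cocycle_twistP w 0 (short 1 0) u 0) => //.
- by split; apply/eqP; rewrite ?F0 ?F1.
- by apply/curve_iso_short; split; rewrite // ?u4 ?opprK // mulr0 expr0n subr0.
- rewrite frob_F9 ?n_odd; last first.
    by rewrite (_ : 9%N = (4 * 2 + 1)%N) // exprD exprM u4 sqrrN expr1n mul1r.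
  by rewrite exprS uw invfM invrK mulrA divff // mul1r.
- by rewrite F0 subrr mul0r.
- exact: cocycle_degree_imag_odd.
Qed.

Let in_Fq_neg1 : (-1) ^+ q = -1 :> K. Proof. exact: cube_id_exp. Qed.

(** If r^3 - r = d then (x, y) |-> (x + r, y) maps E to y^2 = x^3 - x - d, and
    r^q - r is the trace of d. *)
Lemma cocycle_twist_cubic (d : K) s : d \in Fq K q -> trace3 n d = - s ->
  s ^+ 3 = s -> s != 0 -> cocycle_twist q (Phi 1 s) (short (-1) (- d)) 3.
Proof.
move=> dq trd s3 s0.
have /closed_rootP [r] : size (Poly [:: - d; -1; 0; 1]) != 1%N.
  by rewrite (PolyK (c := 1)) //= oner_eq0.
rewrite /root horner_Poly /= => /eqP rd.
have rE : r ^+ 3 - r = d.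
  by apply/eqP; rewrite -subr_eq0 -[X in _ == X]rd; apply/eqP; ring.
have F0 : 0 ^+ q = 0 :> K by rewrite expr0n gtn_eqF ?expn_gt0.
have F1 : 1 ^+ q = 1 :> K by rewrite expr1n.
have trr := trace3E r; rewrite rE trd in trr.
apply: (@cocycle_twistP 1 s _ 1 r) => //.
- split; apply/eqP; rewrite ?F0 //=.
  by rewrite -frobRE rmorphN frobRE (eqP dq).
- apply/curve_iso_short; rewrite oner_neq0 expr1n mul1r; split=> //.
  by rewrite -rE opprB.
- by rewrite F1 divr1.
- by rewrite F1 expr1n divr1 -opprB -trr opprK.
apply: cocycle_degree_real => //; rewrite ?expr1n ?three0 ?mulr0 //.
move=> [|[|[|m]]] // _ _ /eqP; rewrite mulf_eq0 (negPf s0) /=.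
  by rewrite oner_eq0.
by rewrite (negPf two_neq0).
Qed.

Lemma trace3N (d : K) : trace3 n (- d) = - trace3 n d.
Proof.
rewrite /trace3 -sumrN; apply: eq_bigr => k _.
by have := rmorphN (frobR k) d; rewrite !frobRE.
Qed.

Lemma trace3_1 : trace3 n 1 = (n %% 3)%:R :> K.
Proof.
rewrite /trace3; under eq_bigr do rewrite expr1n.
rewrite sumr_const card_ord [in LHS](divn_eq n 3) natrD natrM three0.
by rewrite mulr0 add0r.
Qed.

(** If r^q = r - 1 then r^3 - r is in F_q and has trace r^q - r. *)
Lemma trace3_onto : exists2 d : K, d \in Fq K q & trace3 n d = -1.
Proof.
have [r rq] := artin_schreier 1 n_gt0; exists (r ^+ 3 - r).
  apply/eqP; rewrite -frobRE rmorphB rmorphXn !frobRE rq.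
  by apply: (@eq_char3 _ _ (- r ^+ 2 + r)); ring.
by rewrite trace3E rq addrAC subrr add0r.
Qed.

Lemma twists_by_trace (d : K) : d \in Fq K q -> trace3 n d = -1 ->
  [/\ cocycle_twist q (Phi 1 1) (short (-1) (- d)) 3,
      cocycle_twist q (Phi 1 (-1)) (short (-1) d) 3 &
      nontrivial_twist_classes q E
        = [set cls (short 1 0); cls (short (-1) (- d)); cls (short (-1) d)]].
Proof.
move=> dq trd.
have T2 : cocycle_twist q (Phi 1 1) (short (-1) (- d)) 3.
  exact: cocycle_twist_cubic dq trd e3 (oner_neq0 K).
have T3 : cocycle_twist q (Phi 1 (-1)) (short (-1) d) 3.
  rewrite -{1}(opprK d); apply: cocycle_twist_cubic => //.
  - by apply/eqP; rewrite -frobRE rmorphN frobRE (eqP dq).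
  - by rewrite trace3N trd.
  - by rewrite oppr_eq0 oner_eq0.
by split=> //; exact: nontrivial_twists_odd (cocycle_twist_quartic i2) T2 T3.
Qed.

Let in_Fq1 : 1 \in Fq K q. Proof. by apply/eqP; rewrite expr1n. Qed.
Let in_FqN1 : -1 \in Fq K q. Proof. exact/eqP. Qed.

Let trace3_mod2 : (n %% 3 = 2)%N -> trace3 n 1 = -1 :> K.
Proof.
by move=> n2; rewrite trace3_1 n2; apply: (@eq_char3 _ _ 1); ring.
Qed.

Let trace3_mod1 : (n %% 3 = 1)%N -> trace3 n (-1) = -1 :> K.
Proof. by move=> n1; rewrite trace3N trace3_1 n1. Qed.

Lemma twists_not_dvd3 : ~~ (3 %| n)%N ->
  nontrivial_twist_classes q E
    = [set cls (short 1 0); cls (short (-1) (-1)); cls (short (-1) 1)].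
Proof.
move=> n3; have : (n %% 3 < 3)%N by rewrite ltn_mod.
move: n3; rewrite /dvdn; case E3: (n %% 3)%N => [|[|[|]]] // _ _.
  have [_ _ ->] := twists_by_trace in_FqN1 (trace3_mod1 E3).
  by rewrite opprK setUAC.
by have [_ _ ->] := twists_by_trace in_Fq1 (trace3_mod2 E3).
Qed.

Lemma twists_mod2 : (n %% 3 = 2)%N ->
  cocycle_twist q (@Phi K 1 1) (short (-1) (-1)) 3 /\
  cocycle_twist q (@Phi K 1 (-1)) (short (-1) 1) 3.
Proof. by move/trace3_mod2/(twists_by_trace in_Fq1) => [? ? _]. Qed.

Lemma twists_mod1 : (n %% 3 = 1)%N ->
  cocycle_twist q (@Phi K 1 1) (short (-1) 1) 3 /\
  cocycle_twist q (@Phi K 1 (-1)) (short (-1) (-1)) 3.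
Proof.
by move/trace3_mod1/(twists_by_trace in_FqN1) => [+ ? _]; rewrite opprK.
Qed.

End Odd.

Section Even.
Hypothesis n_even : ~~ odd n.

Lemma i_in_Fq : i \in Fq K q.
Proof. by apply/eqP; rewrite frob_mu4 // (negPf n_even). Qed.

Lemma Frob_classes_even : Frob_classes q E =
  [set C 1 0; C (-1) 0; C 1 1; C (-1) 1; C i 0; C (- i) 0].
Proof.
rewrite Frob_classes_reps /reps (negPf n_even); apply/seteqP; split=> A.
  move=> [p]; rewrite /= !inE.
  move=> /orP[/eqP->|/orP[/eqP->|/orP[/eqP->|
    /orP[/eqP->|/orP[/eqP->|/eqP->]]]]] <-.
  - by do 5 left.
  - by do 4 left; right.
  - by do 3 left; right.
  - by do 2 left; right.
  - by left; right.
  - by right.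
by case=> [[[[[]|]|]|]|] ->; [exists (1, 0)|exists (-1, 0)|exists (1, 1)|
  exists (-1, 1)|exists (i, 0)|exists (- i, 0)]; rewrite //= !inE eqxx ?orbT.
Qed.

(** The elements of the class are Phi_{v,s} and Phi_{v,-s}, with the same
    degree. *)
Lemma class_degree_real v s d : v ^+ 2 = 1 -> s ^+ 3 = s ->
  v ^+ d = 1 -> s * d%:R = 0 ->
  (forall m, (0 < m)%N -> v ^+ m = 1 -> s * m%:R = 0 -> (d <= m)%N) ->
  class_degree q (C v s) d.
Proof.
move=> v2 s3 vd sd dmin; have v4 : v ^+ 4 = 1 by apply/expr4_eq1P; left.
apply: class_degreeP => // v' s' v'4 s'3;
  rewrite Cset_real // eps_even // mulr1.
case=> /(Phi_inj v'4 s'3 v4) => [/(_ s3)|/(_ (F3_opp s3))] [-> ->].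
  exact: cocycle_degree_real.
apply: cocycle_degree_real => //; [exact: F3_opp|by rewrite mulNr sd oppr0|].
by move=> m m0 vm /eqP; rewrite mulNr oppr_eq0 => /eqP; apply: dmin.
Qed.

Lemma class_degree_imag v : v ^+ 2 = -1 -> class_degree q (C v 0) 4.
Proof.
move=> v2; have v4 : v ^+ 4 = 1 by apply/expr4_eq1P; right.
apply: class_degreeP => // v' s' v'4 s'3 /mem_Cset [] // t [r [_ _ v'E _]].
by apply: cocycle_degree_imag; rewrite // v'E eps_even // mulr1.
Qed.

Let dmin_of_F3 s m : s != 0 -> s * m%:R = 0 -> (3 %| m)%N.
Proof.
move=> s0 /eqP; rewrite mulf_eq0 (negPf s0) /= => m0.
by rewrite (dvdn_pcharf char3).
Qed.

Let dmin_of_neg1 m : (-1) ^+ m = 1 :> K -> (2 %| m)%N.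
Proof.
rewrite dvdn2 -signr_odd; case: odd => //= /eqP.
by rewrite expr1 (negPf neg1_neq1).
Qed.

Lemma class_degrees_real :
  [/\ class_degree q (C 1 0) 1, class_degree q (C (-1) 0) 2,
      class_degree q (C 1 1) 3 & class_degree q (C (-1) 1) 6].
Proof.
have e0 := oner_neq0 K; have six : 6%:R = 0 :> K.
  by rewrite (natrM _ 2 3) three0 mulr0.
split; apply: class_degree_real;
  rewrite ?expr1n ?mul0r ?mul1r ?sqrrN ?expr1n //.
- by move=> m m0 /dmin_of_neg1 m2 _; apply: dvdn_leq.
- by move=> m m0 _ m3; apply: dvdn_leq => //; apply: dmin_of_F3 e0 m3.
- by rewrite -signr_odd.
move=> m m0 /dmin_of_neg1 m2 m3; apply: dvdn_leq => //.
by rewrite (@Gauss_dvd 2 3) // m2; apply: dmin_of_F3 e0 m3.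
Qed.

End Even.

End Main.

End Twists.

End EllipticCurves.

Theorem proposition2p1
  (K : closedFieldType) (iota : {rmorphism 'F_3 -> K})
  (algK : integralRange iota) (n : nat) (n_gt0 : (0 < n)%N)
  (i : K) (i2 : i ^+ 2 = -1) :
  let E := E0 K in
  let q := (3 ^ n)%N in
  let Phi := @Phi K in
  let C := @Cset K q in
  let cls := iso_class (Fq K q) in
  (* E and its automorphisms *)
  [/\ elliptic_over E (Fq K 3),
      jinv E = 0,
      ECAut E #= `I_12 &
      ECAut E = [set phi | exists u r,
        [/\ u ^+ 4 = 1, r \in Fq K 3 & phi = Phi u r]]] /\
  (* C_{u,r} is the Frobenius conjugacy class of Phi_{u,r} *)
  (forall u r : K, u ^+ 4 = 1 -> r \in Fq K 3 ->
     Frob_class q (Phi u r) = C u r) /\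
  (* (a) *)
  (odd n ->
     [/\ Frob_classes q E
           = [set C 1 0; C 1 1; C 1 (-1); C i 0],
         Frob_classes q E #= `I_4,
         C 1 0 = [set Phi 1 0; Phi (-1) 0],
         C 1 1 = [set Phi 1 1; Phi (-1) (-1)] &
         C 1 (-1) = [set Phi 1 (-1); Phi (-1) 1]] /\
     C i 0 = [set phi | exists u r,
        [/\ u ^+ 2 = -1, r \in Fq K 3 & phi = Phi u r]] /\
     nontrivial_twist_classes q E #= `I_3 /\
     (forall u : K, u ^+ 2 = -1 ->
        cocycle_twist q (Phi u 0) (short 1 0) 2) /\
     (exists2 d : K, d \in Fq K q & trace3 n d = -1) /\
     (forall d : K, d \in Fq K q -> trace3 n d = -1 ->
        [/\ cocycle_twist q (Phi 1 1) (short (-1) (- d)) 3,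
            cocycle_twist q (Phi 1 (-1)) (short (-1) d) 3 &
            nontrivial_twist_classes q E
              = [set cls (short 1 0); cls (short (-1) (- d));
                     cls (short (-1) d)]]) /\
     (~~ (3 %| n)%N ->
        nontrivial_twist_classes q E
          = [set cls (short 1 0); cls (short (-1) (-1));
                 cls (short (-1) 1)]) /\
     ((n %% 3 = 2)%N ->
        cocycle_twist q (Phi 1 1) (short (-1) (-1)) 3 /\
        cocycle_twist q (Phi 1 (-1)) (short (-1) 1) 3) /\
     ((n %% 3 = 1)%N ->
        cocycle_twist q (Phi 1 1) (short (-1) 1) 3 /\
        cocycle_twist q (Phi 1 (-1)) (short (-1) (-1)) 3)) /\
  (* (b) *)
  (~~ odd n ->
     i \in Fq K q /\
     Frob_classes q E
       = [set C 1 0; C (-1) 0; C 1 1; C (-1) 1;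
              C i 0; C (- i) 0] /\
     Frob_classes q E #= `I_6 /\
     [/\ C 1 0 = [set Phi 1 0],
         C (-1) 0 = [set Phi (-1) 0],
         C 1 1 = [set Phi 1 1; Phi 1 (-1)] &
         C (-1) 1 = [set Phi (-1) 1; Phi (-1) (-1)]] /\
     C i 0 = [set Phi i r | r in [set r | r \in Fq K 3]] /\
     C (- i) 0 = [set Phi (- i) r | r in [set r | r \in Fq K 3]] /\
     [/\ class_degree q (C 1 0) 1,
         class_degree q (C (-1) 0) 2,
         class_degree q (C 1 1) 3 &
         class_degree q (C (-1) 1) 6] /\
     class_degree q (C i 0) 4 /\
     class_degree q (C (- i) 0) 4) /\
  (* curves with j = 0 *)
  (forall E' : weierstrass K, elliptic_over E' (Fq K q) ->
     (jinv E' = 0 <-> supersingular 3 E')) /\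
  [set cls E' | E' in [set E' | elliptic_over E' (Fq K q) /\ jinv E' = 0]]
    #= `I_(if odd n then 4 else 6).
Proof.
have char3 : 3%N \in [pchar K] by apply: (rmorph_pchar iota); apply: pchar_Fp.
move=> E q Phi C cls.
have d0 : disc (E0 K) != 0 := curve_iso_elliptic char3 (curve_iso_id (E0 K)).
have FrobC u r : u ^+ 4 = 1 -> r \in Fq K 3 ->
    Frob_class q (Phi u r) = C u r.
  by move=> u4 /in_F3 r3; apply: Frob_class_Phi.
split; [split|split; [exact: FrobC|split; [move=> n_odd|
  split; [move=> n_even|split]]]].
- by split; [exact: (coefs_in_E0 K 1)|exact: d0].
- apply/(jinv_eq0 char3); first exact: d0.
  by have /(curve_isoP char3)[] := curve_iso_id (E0 K).
- exact: card_ECAut i2.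
- apply/seteqP; split=> phi.
    by move=> /(ECAutP char3) [u [r [u4 /in_F3 r3 ->]]]; exists u, r.
  by move=> [u [r [u4 /in_F3 r3 ->]]]; apply/(ECAutP char3); exists u, r.
- have N1_3 : (-1) ^+ 3 = -1 :> K by apply/cube_idP; apply: Or33.
  have z3 : 0 ^+ 3 = 0 :> K by rewrite expr0n.
  have e3 : 1 ^+ 3 = 1 :> K by rewrite expr1n.
  have e2 : 1 ^+ 2 = 1 :> K by rewrite expr1n.
  split.
    split.
    + exact: Frob_classes_odd.
    + by have := card_Frob_classes char3 n i2; rewrite n_odd.
    + by rewrite /C (Cset_real char3 n e2 z3) eps_odd // mul1r oppr0.
    + by rewrite /C (Cset_real char3 n e2 e3) eps_odd // mul1r.
    + by rewrite /C (Cset_real char3 n e2 N1_3) eps_odd // mul1r opprK.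
  split; first exact: Cset_imag_odd.
  split; first exact: card_nontrivial_twists_odd i2 n_odd.
  split; first by move=> u; exact: cocycle_twist_quartic.
  split; first exact: trace3_onto.
  split; first by move=> d; exact: (twists_by_trace char3 n_gt0 i2 n_odd).
  split; first exact: (twists_not_dvd3 char3 n_gt0 i2 n_odd).
  by split; [exact: (twists_mod2 char3 n_gt0 i2 n_odd)|exact: (twists_mod1
    char3 n_gt0 i2 n_odd)].
- have z3 : 0 ^+ 3 = 0 :> K by rewrite expr0n.
  have e3 : 1 ^+ 3 = 1 :> K by rewrite expr1n.
  have e2 : 1 ^+ 2 = 1 :> K by rewrite expr1n.
  have Ne2 : (-1) ^+ 2 = 1 :> K by rewrite sqrrN e2.
  have Ni2 : (- i) ^+ 2 = -1 by rewrite sqrrN.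
  split; first exact: i_in_Fq.
  split; first exact: Frob_classes_even.
  split; first by have := card_Frob_classes char3 n i2; rewrite (negPf n_even).
  split.
    split.
    + by rewrite /C (Cset_real char3 n e2 z3) eps_even // mulr1 oppr0 setUid.
    + by rewrite /C (Cset_real char3 n Ne2 z3) eps_even // mulr1 oppr0 setUid.
    + by rewrite /C (Cset_real char3 n e2 e3) eps_even // mulr1.
    + by rewrite /C (Cset_real char3 n Ne2 e3) eps_even // mulr1.
  split; first exact: Cset_imag_even.
  split; first exact: Cset_imag_even.
  split; first exact: class_degrees_real.
  by split; exact: class_degree_imag.
- by move=> E' [_ d0']; exact: supersingularP.
- exact: card_jinv0 i2.
Qed.
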